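(* Let $A=(A_{ij})\in\mathbb{R}_{\min}^{n\times n}$ be irreducible, $a=(a_{ij})\in\mathbb{C}^{n\times n}$, and let $\mathcal{A}\in\mathcal{C}^{n\times n}$ satisfy $(\mathcal{A}_\epsilon)_{ij}\simeq a_{ij}\epsilon^{A_{ij}}$ for all $i,j$. Let $\alpha_\ell$, $C_\ell$, $C^\ell$, $N^\ell$, $\hat A$ be associated to $A$ as in the context, and let $s^\ell,r^\ell,t^\ell$, $\ell=1,\ldots,k$, be constructed with $G=G^c(\hat A)$ or, equivalently, with $G=\mathrm{Sat}(\hat A,V)$ for some eigenvector $V$ of $\hat A$. Assume that the matrix $r^\ell$ is invertible for some $1\leq\ell\leq k$, and let $\lambda^\ell_1,\ldots,\lambda^\ell_{m_\ell}$ denote the non-zero eigenvalues of $t^\ell$ (eigenvalues are repeated with multiplicities). Then the eigenvalues of $\mathcal{A}_\epsilon$ can be grouped in (1) $m_\ell$ eigenvalues with asymptotic expansions $\mathcal{L}^{\ell,j}_\epsilon\sim\lambda^\ell_j\epsilon^{\alpha_\ell}$, $1\leq j\leq m_\ell$; (2) $\#C^{\ell-1}$ eigenvalues of order $\omega(\epsilon^{\alpha_\ell})$; (3) $\#N^\ell-m_\ell$ eigenvalues of order $o(\epsilon^{\alpha_\ell})$. In particular, when $t^1,\ldots,t^k$ are all invertible, for all $1\leq\ell\leq k$, $\mathcal{A}_\epsilon$ has exactly $\#C_\ell$ eigenvalues of order $\epsilon^{\alpha_\ell}$, whose asymptotics are given by $\mathcal{L}^{\ell,j}_\epsilon\sim\lambda^\ell_j\epsilon^{\alpha_\ell}$,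 $1\leq j\leq m_\ell=\#C_\ell$.
   Context: Asymptotics. $\mathcal{C}$ is the ring of germs at $0$ of continuous functions $f:(0,\epsilon_0)\to\mathbb{C}$ ($\epsilon_0>0$) such that $|f(\epsilon)|\leq\epsilon^{-k}$ on $(0,\epsilon_0)$ for some positive constant $k$. For $f\in\mathcal{C}$, $b\in\mathbb{C}$, $B\in\mathbb{R}\cup\{+\infty\}$: $f(\epsilon)\simeq b\epsilon^B$ means $\lim_{\epsilon\to0}\epsilon^{-B}f(\epsilon)=b$ if $B\in\mathbb{R}$, and $f=0$ near $0$ if $B=+\infty$. For $b\neq0$, $B\in\mathbb{R}$, $f(\epsilon)\sim b\epsilon^B$ means $\lim_{\epsilon\to0}\epsilon^{-B}f(\epsilon)=b$. A function $f(\epsilon)$ is of order $\omega(\epsilon^\alpha)$ if $\lim_{\epsilon\to0}|f(\epsilon)\epsilon^{-\alpha}|=+\infty$. Min-plus notions. $\mathbb{R}_{\min}=\mathbb{R}\cup\{+\infty\}$ with $a\oplus b=\min(a,b)$ and multiplication $ab=a+b$; matrix operations over $\mathbb{R}_{\min}$ are taken in this sense. For a finite set $L$ and an $L\times L$ matrix $B$ over $\mathbb{R}_{\min}$, $G(B)$ is the digraph with node set $L$ and an arc $(i,j)$ whenever $B_{ij}\neq+\infty$; $B$ is irreducible if $G(B)$ is strongly connected. (When $n=1$, the matrix $(+\infty)$ is excluded.) $\rho_{\min}(B)=\min_c|c|_B/|c|$ over circuits $c$ of $G(B)$, where $|c|_B$ is the sum of the entries of $B$ along the arcs of $c$ and $|c|$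 its number of arcs ($+\infty$ if there are no circuits); for irreducible $B$ it is the unique min-plus eigenvalue. Circuits attaining the minimum are critical; the critical graph $G^c(B)$ consists of the nodes (critical nodes) and arcs of critical circuits. An eigenvector of an irreducible $B$ is a vector $V\in\mathbb{R}_{\min}^L$, not identically $+\infty$, with $BV=\rho_{\min}(B)V$. The saturation graph $\mathrm{Sat}(B,V)$ has node set $L$ and an arc $(i,j)$ if $(BV)_i=B_{ij}+V_j$. Min-plus Schur complement: for $C\subset L$, $N=L\setminus C$, $\lambda\in\mathbb{R}$ with $\lambda\leq\rho_{\min}(B_{CC})$, $\mathrm{Schur}(C,\lambda,B)=B_{NN}\oplus B_{NC}(\lambda^{-1}B_{CC})^*\lambda^{-1}B_{CN}$, where $\lambda^{-1}M$ is $M$ with $\lambda$ subtracted from every entry and $M^*=I\oplus M\oplus M^2\oplus\cdots$. Construction from $A$: put $A_1=A$ and, for $\ell\geq1$, $\alpha_\ell=\rho_{\min}(A_\ell)$, $C_\ell$ the set of critical nodes of $A_\ell$, and, as long as $C_1\cup\cdots\cup C_\ell\neq\{1,\ldots,n\}$, $A_{\ell+1}=\mathrm{Schur}(C_\ell,\alpha_\ell,A_\ell)$. This stops at some $k\leq n$, and $\alpha_1<\cdots<\alpha_k$. Put $C^0=\emptyset$, $C^\ell=C_1\cup\cdots\cup C_\ell$, $N^\ell=\{1,\ldots,n\}\setminus C^{\ell-1}$. The matrix $\hat A$ is defined by $\hat A_{ij}=A_{ij}-\alpha_m$ for $i\in C_m$ (all $i,j$); it is irreducible with $\rho_{\min}(\hat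 A)=0$. Complex Schur complements: for a graph $G$ on $\{1,\ldots,n\}$ and $b\in\mathbb{C}^{n\times n}$, $b^G$ has entries $b_{ij}$ if $(i,j)\in G$ and $0$ otherwise. For a complex $L\times L$ matrix $s$ with $s_{CC}$ invertible, $\mathrm{Schur}(C,s)=s_{NN}-s_{NC}(s_{CC})^{-1}s_{CN}$, $N=L\setminus C$. Define $r^\ell=a^G_{C^{\ell-1},C^{\ell-1}}$ ($r^1$ is the empty matrix, considered invertible), $s^1=a^G$, $s^\ell=\mathrm{Schur}(C^{\ell-1},s^1)$ for $\ell=2,\ldots,k$ (well defined when $r^\ell$ is invertible; it is indexed by $N^\ell$), and $t^\ell=s^\ell_{C_\ell C_\ell}$. *)

(* Defs.v *)
From HB Require Import structures.
From mathcomp Require Import all_boot all_order all_algebra.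
From mathcomp Require Import complex.
From mathcomp Require Import all_classical all_reals all_analysis.

Set Implicit Arguments.
Unset Strict Implicit.
Unset Printing Implicit Defensive.

Import Order.TTheory GRing.Theory Num.Theory.
Import numFieldNormedType.Exports.

Local Open Scope classical_set_scope.
Local Open Scope set_scope.
Local Open Scope complex_scope.
Local Open Scope ring_scope.

(* Germs at 0+ are represented by total functions R -> R[i], every condition
   being imposed near 0+ only.  The topology of the complex numbers is the one
   of the regular normed module R[i]^o. *)
Section Germs.
Variable R : realType.
Implicit Types (f : R -> R[i]) (b : R[i]) (B : R).

Definition in_C f : Prop :=
  exists eps0 k : R, [/\ 0 < eps0, 0 < k,
    {in `]0, eps0[, continuous (f : R -> R[i]^o)} &
    {in `]0, eps0[, forall eps, `|f eps| <= (eps `^ (- k))%:C}].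

Definition scaled_lim f b B : Prop :=
  (fun eps : R => (eps `^ (- B))%:C * f eps : R[i]^o) @ 0^'+ --> (b : R[i]^o).

(* f ~= b eps^B, with B in R or B = +oo *)
Definition asymp_simeq f b (B : \bar R) : Prop :=
  match B with
  | r%:E => scaled_lim f b r
  | +oo%E => \forall eps \near 0^'+, f eps = 0
  | -oo%E => False
  end.

Definition asymp_sim f b B : Prop := b != 0 /\ scaled_lim f b B.

Definition of_order f B : Prop := exists b, asymp_sim f b B.

Definition of_order_omega f B : Prop :=
  (fun eps : R => Normc.normc (f eps) * eps `^ (- B)) @ 0^'+ --> +oo.

Definition of_order_o f B : Prop :=
  (fun eps : R => Normc.normc (f eps) * eps `^ (- B)) @ 0^'+ --> (0 : R).

End Germs.

(* R_min is \bar R without -oo: the sum is adde, the unit of min is +oo.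
   A matrix indexed by a subset L of 'I_n is represented by an n x n matrix of
   which only the entries in L x L are relevant. *)
Section MinPlus.
Variable R : realType.

Definition is_Rmin m n (B : 'M[\bar R]_(m, n)) : Prop :=
  forall i j, B i j != -oo%E.

(* product of the columns of M by the rows of M' that are indexed by C *)
Definition mp_mul m n p (C : {set 'I_n}) (M : 'M[\bar R]_(m, n))
    (M' : 'M[\bar R]_(n, p)) : 'M[\bar R]_(m, p) :=
  \matrix_(i, j) \big[mine/+oo%E]_(q in C) (M i q + M' q j)%E.

Definition mp_id n : 'M[\bar R]_n :=
  \matrix_(i, j) if i == j then 0%E else +oo%E.

(* lam^{-1} M *)
Definition mp_unscale m n (lam : R) (M : 'M[\bar R]_(m, n)) :
    'M[\bar R]_(m, n) := \matrix_(i, j) (M i j - lam%:E)%E.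

Definition mp_pow n (C : {set 'I_n}) (M : 'M[\bar R]_n) (k : nat) :
    'M[\bar R]_n := iter k (mp_mul C M) (mp_id n).

Definition mp_star n (C : {set 'I_n}) (M : 'M[\bar R]_n) : 'M[\bar R]_n :=
  \matrix_(i, j) ereal_inf (range (fun k : nat => mp_pow C M k i j)).

(* relevant on (L minus C) x (L minus C) when B is an L x L matrix *)
Definition mp_schur n (C : {set 'I_n}) (lam : R) (B : 'M[\bar R]_n) :
    'M[\bar R]_n :=
  \matrix_(i, j) mine (B i j)
    (mp_mul C B
      (mp_mul C (mp_star C (mp_unscale lam B)) (mp_unscale lam B)) i j).

Definition mp_arc n (B : 'M[\bar R]_n) : rel 'I_n :=
  [rel i j | B i j != +oo%E].

Definition mp_irreducible n (B : 'M[\bar R]_n) : Prop :=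
  (forall i j, connect (mp_arc B) i j) /\
  (n = 1%N -> B <> const_mx +oo%E).

Definition circuit_arcs (T : Type) (c : seq T) : seq (T * T) :=
  zip c (rot 1 c).

(* c lists the successive nodes of a closed walk, the first node not being
   repeated at the end, so that size c is the number of arcs.  Circuits need not
   be elementary; this changes neither rho_min nor the critical graph. *)
Definition is_circuit n (L : {set 'I_n}) (B : 'M[\bar R]_n)
    (c : seq 'I_n) : bool :=
  [&& c != [::], all (mem L) c & cycle (mp_arc B) c].

Definition circuit_mean n (B : 'M[\bar R]_n) (c : seq 'I_n) : \bar R :=
  ((\sum_(p <- circuit_arcs c) B p.1 p.2) * ((size c)%:R^-1)%:E)%E.

Definition rho_min n (L : {set 'I_n}) (B : 'M[\bar R]_n) : \bar R :=
  ereal_inf [set circuit_mean B c | c in [set c | is_circuit L B c]]%classic.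

Definition is_critical n (L : {set 'I_n}) (B : 'M[\bar R]_n)
    (c : seq 'I_n) : Prop :=
  is_circuit L B c /\ circuit_mean B c = rho_min L B.

Definition critical_nodes n (L : {set 'I_n}) (B : 'M[\bar R]_n) : {set 'I_n} :=
  [set i | `[< exists2 c, is_critical L B c & i \in c >]]%SET.

Definition critical_graph n (L : {set 'I_n}) (B : 'M[\bar R]_n) :
    {set 'I_n * 'I_n} :=
  [set p | `[< exists2 c, is_critical L B c & p \in circuit_arcs c >]]%SET.

Definition mp_eigenvector n (B : 'M[\bar R]_n) (V : 'cV[\bar R]_n) : Prop :=
  [/\ is_Rmin V, exists i, V i ord0 != +oo%E &
      forall i, mp_mul [set: 'I_n]%SET B V i ord0 =
        (rho_min [set: 'I_n]%SET B + V i ord0)%E].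

Definition sat_graph n (B : 'M[\bar R]_n) (V : 'cV[\bar R]_n) :
    {set 'I_n * 'I_n} :=
  [set p | mp_mul [set: 'I_n]%SET B V p.1 ord0 == (B p.1 p.2 + V p.2 ord0)%E]%SET.

End MinPlus.

(* The levels are numbered from 1.  The construction is total: after the last
   level the set of remaining nodes is empty and the matrix is irrelevant.
   For irreducible A and 1 <= l <= nb_levels A the eigenvalue of A_l is finite,
   so that the use of fine in alpha loses nothing. *)
Section Levels.
Variables (R : realType) (n : nat) (A : 'M[\bar R]_n).

Definition next_level (S : {set 'I_n} * 'M[\bar R]_n) :
    {set 'I_n} * 'M[\bar R]_n :=
  let C := critical_nodes S.1 S.2 in
  (S.1 :\: C, mp_schur C (fine (rho_min S.1 S.2)) S.2).

(* the index set of A_l, and A_l *)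
Definition level (l : nat) : {set 'I_n} * 'M[\bar R]_n :=
  iter l.-1 next_level ([set: 'I_n]%SET, A).

Definition alpha (l : nat) : R := fine (rho_min (level l).1 (level l).2).

(* C_l *)
Definition C_lvl (l : nat) : {set 'I_n} :=
  critical_nodes (level l).1 (level l).2.

(* C^l *)
Definition C_cum (l : nat) : {set 'I_n} :=
  (\bigcup_(1 <= m < l.+1) C_lvl m)%SET.

(* N^l *)
Definition N_cum (l : nat) : {set 'I_n} := ~: C_cum l.-1.

(* k, the least l (necessarily <= n) such that C^l = {1, ..., n} *)
Definition nb_levels : nat :=
  find (fun l => C_cum l == [set: 'I_n]%SET) (iota 0 n.+1).

(* the m >= 1 such that i is in C_m *)
Definition level_of (i : 'I_n) : nat :=
  (find (fun m => i \in C_lvl m) (iota 1 n)).+1.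

Definition hatA : 'M[\bar R]_n :=
  \matrix_(i, j) (A i j - (alpha (level_of i))%:E)%E.

(* the two possible choices for the graph G *)
Definition admissible_graph (G : {set 'I_n * 'I_n}) : Prop :=
  G = critical_graph [set: 'I_n]%SET hatA \/
  exists2 V, mp_eigenvector hatA V & G = sat_graph hatA V.

End Levels.

Section ComplexSchur.
Variable (K : fieldType) (n : nat).
Implicit Types (C D : {set 'I_n}) (s : 'M[K]_n).

Definition graph_part (G : {set 'I_n * 'I_n}) (b : 'M[K]_n) : 'M[K]_n :=
  \matrix_(i, j) if (i, j) \in G then b i j else 0.

Definition sub_mx C D s : 'M[K]_(#|C|, #|D|) :=
  mxsub (@enum_val _ (mem C)) (@enum_val _ (mem D)) s.

(* Schur(C, s), relevant on the complement N of C, where its entries are those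
   of s_NN - s_NC (s_CC)^-1 s_CN; for C empty, it is s *)
Definition schur C s : 'M[K]_n :=
  s - colsub (@enum_val _ (mem C)) s *m invmx (sub_mx C C s)
        *m rowsub (@enum_val _ (mem C)) s.

End ComplexSchur.

Section LevelMatrices.
Variables (R : realType) (n : nat) (A : 'M[\bar R]_n) (a : 'M[R[i]]_n).
Variable G : {set 'I_n * 'I_n}.

Definition r_mx (l : nat) : 'M[R[i]]_#|C_cum A l.-1| :=
  sub_mx (C_cum A l.-1) (C_cum A l.-1) (graph_part G a).

(* relevant on N_cum A l *)
Definition s_mx (l : nat) : 'M[R[i]]_n :=
  schur (C_cum A l.-1) (graph_part G a).

Definition t_mx (l : nat) : 'M[R[i]]_#|C_lvl A l| :=
  sub_mx (C_lvl A l) (C_lvl A l) (s_mx l).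

End LevelMatrices.

(* mu lists the eigenvalues of M, repeated with multiplicities *)
Definition spectrum (K : fieldType) m (M : 'M[K]_m) (mu : seq K) : Prop :=
  char_poly M = \prod_(z <- mu) ('X - z%:P).

Definition nonzeros (K : fieldType) (mu : seq K) : seq K :=
  [seq z <- mu | z != 0].

(* The germs Lam i are in C and are, near 0+, the eigenvalues of AA eps,
   repeated with multiplicities. *)
Definition eigenvalue_germs (R : realType) n (AA : R -> 'M[R[i]]_n)
    (I : finType) (Lam : I -> R -> R[i]) : Prop :=
  (forall i, in_C (Lam i)) /\
  \forall eps \near 0^'+,
    char_poly (AA eps) = \prod_(i : I) ('X - (Lam i eps)%:P).

(* Main.v *)
Require Import Defs.
From HB Require Import structures.
From mathcomp Require Import all_boot all_order all_algebra.
From mathcomp Require Import complex perm ring lra zify.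
From mathcomp Require Import all_classical all_reals all_analysis.

Set Implicit Arguments.
Unset Strict Implicit.
Unset Printing Implicit Defensive.

Import Order.TTheory GRing.Theory Num.Theory.
Import numFieldNormedType.Exports.

Local Open Scope complex_scope.
Local Open Scope ring_scope.

(** Let m(i) be the level of the node i. The heart of the matter is a real
    vector V with A_ij >= alpha_m(i) + V_i - V_j for all i, j
    ([global_potential]). Conjugate the matrix by diag(eps^V_i), substitute
    z eps^alpha_l for the spectral variable, and divide row i by
    eps^min(alpha_m(i), alpha_l). The entries then converge ([scaled_char_poly]).
    Only the arcs where the inequality is an equality contribute to the limit,
    and since alpha_1 < ... < alpha_k, the limit of row i is a row of - a^T if
    m(i) < l, of z I - a^T if m(i) = l, and of z I if m(i) > l, where T is the
    graph of these arcs. By the Schur complement formula the determinant of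
    the limit is, up to a power of z, det(- r^l) times the characteristic
    polynomial of t^l ([det_pencil]). So, once divided by eps^alpha_l, #N^l
    eigenvalues tend to the eigenvalues of t^l and to 0, and the other ones
    leave every bounded set, because the degree of the limit has dropped. A
    Moebius transformation z -> 1 / (z - zeta) turns the drop of degree into a
    convergence of monic polynomials of constant degree
    ([scaled_roots_classify]).

    The vector V is built from the last level to the first: a Schur complement
    over C is the matrix of best walks between the remaining nodes, so that a
    potential on these nodes extends to C by taking the best walk that leaves
    C ([potential_extend]). The alpha_l increase strictly because a circuit
    of mean alpha_l in the Schur complement would lift to a critical circuit
    of A_l outside C_l ([mp_schur_rho]).

    The choice of the graph G does not matter: a product of entries along a
    permutation only sees arcs that lie on circuits ([det_pencil_circ]), and
    the arcs on circuits of any admissible G are those of the critical graph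
    of the matrix \hat A ([admissible_circ]).

    Finally the eigenvalues have to be chosen as continuous germs. This is
    Kato's theorem that a continuous family of unordered n-tuples over an
    interval has a continuous ordering ([continuous_selection]), proved by
    induction on n: where the n values do not all agree the family splits
    locally, local orderings are glued along the components of the set of such
    points, and the points where all values agree need no care. A continuous
    branch whose cluster values form a finite set converges ([limit_point]),
    which both makes the gluing possible and gives the asymptotics. *)

#[local] Arguments Normc.normc {R} x : simpl never.

(** * Moduli and limits of complex-valued germs *)

Section Cnorm.
Local Open Scope classical_set_scope.
Local Open Scope ring_scope.
Variable R : realType.
Implicit Types (z : R[i]).
Local Notation nc := (@Normc.normc R).
Lemma ncE z : `|z| = (nc z)%:C. Proof. by []. Qed.
Lemma nc_ge0 z : 0 <= nc z.
Proof. by have := normr_ge0 z; rewrite ncE (lecR 0). Qed.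
Lemma nc_eq0 z : (nc z == 0) = (z == 0).
Proof. by rewrite -(normr_eq0 z) ncE -(inj_eq (@complexI R)). Qed.
Lemma nc0 : nc 0 = 0. Proof. by apply/eqP; rewrite nc_eq0. Qed.
Lemma nc_triangle x y z : nc (x - z) <= nc (x - y) + nc (y - z).
Proof. by have := ler_distD y x z; rewrite !ncE -rmorphD lecR. Qed.
Lemma nc_sym x y : nc (x - y) = nc (y - x).
Proof. by have := distrC x y; rewrite !ncE => /complexI. Qed.
Lemma ncM x y : nc (x * y) = nc x * nc y.
Proof. by have := normrM x y; rewrite !ncE -rmorphM => /complexI. Qed.

Lemma ncC (x : R) : nc x%:C = `|x|.
Proof. by rewrite /Normc.normc /= expr0n addr0 sqrtr_sqr. Qed.

(** Topological convergence in C, with moduli taken in R: real thresholds can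
    be compared, and the intermediate value theorem applies to them. *)
Definition ccvg T (F : set_system T) (f : T -> R[i]) (l : R[i]) : Prop :=
  forall e : R, 0 < e -> \forall t \near F, nc (f t - l) < e.

Lemma ccvgP T (F : set_system T) (FF : Filter F) (f : T -> R[i]) (l : R[i]) :
  ccvg F f l <-> ((f : T -> R[i]^o) @ F --> (l : R[i]^o)).
Proof.
split=> [H|/cvgrPdist_lt fl e e0].
  apply/cvgrPdist_lt => e e0.
  have eE : e = (complex.Re e)%:C by rewrite RRe_real // gtr0_real.
  have e0' : 0 < complex.Re e by move: e0; rewrite {1}eE (ltcR 0).
  apply: filterS (H _ e0') => t.
  by rewrite distrC ncE {2}eE ltcR.
have /fl : 0 < (e%:C) by rewrite (ltcR 0).
by apply: filterS => t; rewrite distrC ncE ltcR.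
Qed.

Section Ops.
Variables (T : Type) (F : set_system T).
Hypothesis FF : Filter F.
Implicit Types (f g : T -> R[i]) (a b : R[i]).

Lemma ccvg_cst a : ccvg F (fun=> a) a.
Proof. by move=> e e0; apply: filterE => t; rewrite subrr ncC normr0. Qed.

Lemma ccvg_near f g a : (\forall t \near F, f t = g t) -> ccvg F f a -> ccvg F g a.
Proof. by move=> fg fa e /fa; apply: filterS2 fg => t ->. Qed.

Lemma ccvgD f g a b : ccvg F f a -> ccvg F g b ->
  ccvg F (fun t => f t + g t) (a + b).
Proof. by move=> /ccvgP fa /ccvgP gb; apply/ccvgP; apply: (cvgD fa gb). Qed.

Lemma ccvgB f g a b : ccvg F f a -> ccvg F g b ->
  ccvg F (fun t => f t - g t) (a - b).
Proof. by move=> /ccvgP fa /ccvgP gb; apply/ccvgP; apply: (cvgB fa gb). Qed.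

Lemma ccvgM f g a b : ccvg F f a -> ccvg F g b ->
  ccvg F (fun t => f t * g t) (a * b).
Proof. by move=> /ccvgP fa /ccvgP gb; apply/ccvgP; apply: (cvgM fa gb). Qed.

Lemma ccvgV f a : a != 0 -> ccvg F f a -> ccvg F (fun t => (f t)^-1) a^-1.
Proof. by move=> a0 /ccvgP fa; apply/ccvgP; apply: (cvgV a0 fa). Qed.

Lemma ccvg_neq f a b : a != b -> ccvg F f a -> \forall t \near F, f t != b.
Proof.
move=> ab /(_ (nc (b - a))); rewrite lt_neqAle eq_sym nc_eq0 nc_ge0 subr_eq0.
rewrite eq_sym ab => /(_ isT); apply: filterS => t; apply: contraTneq => ->.
by rewrite ltxx.
Qed.

Lemma ccvg_sum (I : Type) (r : seq I) (P : pred I) (f : I -> T -> R[i])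
    (a : I -> R[i]) : (forall i, P i -> ccvg F (f i) (a i)) ->
  ccvg F (fun t => \sum_(i <- r | P i) f i t) (\sum_(i <- r | P i) a i).
Proof.
move=> H; elim: r => [|i r IH].
  rewrite big_nil; apply: ccvg_near (ccvg_cst 0).
  by apply: filterE => t; rewrite big_nil.
rewrite big_cons; case: (boolP (P i)) => Pi; last first.
  by apply: ccvg_near IH; apply: filterE => t; rewrite big_cons (negPf Pi).
apply: ccvg_near (ccvgD (H _ Pi) IH).
by apply: filterE => t; rewrite big_cons Pi.
Qed.

Lemma ccvg_prod (I : Type) (r : seq I) (P : pred I) (f : I -> T -> R[i])
    (a : I -> R[i]) : (forall i, P i -> ccvg F (f i) (a i)) ->
  ccvg F (fun t => \prod_(i <- r | P i) f i t) (\prod_(i <- r | P i) a i).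
Proof.
move=> H; elim: r => [|i r IH].
  rewrite big_nil; apply: ccvg_near (ccvg_cst 1).
  by apply: filterE => t; rewrite big_nil.
rewrite big_cons; case: (boolP (P i)) => Pi; last first.
  by apply: ccvg_near IH; apply: filterE => t; rewrite big_cons (negPf Pi).
apply: ccvg_near (ccvgM (H _ Pi) IH).
by apply: filterE => t; rewrite big_cons Pi.
Qed.

Lemma ccvg_det n (M : T -> 'M[R[i]]_n) (M0 : 'M[R[i]]_n) :
  (forall i j, ccvg F (fun t => M t i j) (M0 i j)) ->
  ccvg F (fun t => \det (M t)) (\det M0).
Proof.
move=> H; apply: ccvg_sum => s _; apply: ccvgM; first exact: ccvg_cst.
by apply: ccvg_prod => i _; exact: H.
Qed.

End Ops.

Lemma ccvg_uniq T (F : set_system T) (FF : ProperFilter F) (f : T -> R[i]) a b :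
  ccvg F f a -> ccvg F f b -> a = b.
Proof.
move=> fa fb; apply/eqP/negP => /negP ab.
have d0 : 0 < nc (a - b) / 2.
  by rewrite divr_gt0 // lt_neqAle eq_sym nc_eq0 nc_ge0 subr_eq0 ab.
have [t [ta tb]] := @filter_ex _ _ FF _ (filterI (fa _ d0) (fb _ d0)).
have := nc_triangle a (f t) b; rewrite leNgt; apply/negP; rewrite negbK.
by rewrite nc_sym [ltRHS](splitr (nc (a - b))) ltrD.
Qed.
End Cnorm.

(** * Continuity of the roots of a polynomial *)

(** The way in which a point is found off a finite exceptional set. *)
Lemma inj_avoid (T : eqType) (g : nat -> T) (s : seq T) :
  injective g -> exists k, g k \notin s.
Proof.
move=> gi; apply: contrapT => H.
have sub : {subset [seq g k | k <- iota 0 (size s).+1] <= s}.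
  by move=> _ /mapP[k _ ->]; apply: contrapT => /negP kN; apply: H; exists k.
have := uniq_leq_size _ sub.
by rewrite map_inj_uniq // iota_uniq size_map size_iota ltnn => /(_ isT).
Qed.

Section RootsCvg.
Variable R : realType.
Local Open Scope classical_set_scope.
Local Open Scope ring_scope.
Local Notation nc := (@Normc.normc R).
Local Notation C := R[i].

Definition close (e : R) (s s' : seq C) : bool :=
  all2 (fun x y => nc (x - y) < e) s s'.

(** Convergence of unordered families: the listing s of m t depends on t and on
    the precision. *)
Definition multi_cvg T (F : set_system T) (m : T -> seq C) (s0 : seq C) :=
  forall e : R, 0 < e ->
    \forall t \near F, exists2 s, perm_eq s (m t) & close e s s0.

Lemma closest_ex (y : C) (s : seq C) : s != [::] ->
  exists2 z, z \in s & forall z', z' \in s -> nc (z - y) <= nc (z' - y).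
Proof.
elim: s => [//|a s IH] _; case: (eqVneq s [::]) => [->|/IH[z zs zmin]].
  by exists a; rewrite ?mem_head // => z'; rewrite inE => /eqP->.
case: (leP (nc (a - y)) (nc (z - y))) => H.
  exists a; rewrite ?mem_head // => z'; rewrite inE => /orP[/eqP-> //|/zmin].
  exact: le_trans.
exists z; first by rewrite inE zs orbT.
by move=> z'; rewrite inE => /orP[/eqP->|/zmin //]; exact: ltW.
Qed.

Lemma nc_prod_ge (x : C) (d : R) (s : seq C) : 0 <= d ->
  (forall z, z \in s -> d <= nc (z - x)) ->
  d ^+ size s <= nc (\prod_(z <- s) (x - z)).
Proof.
move=> d0; elim: s => [|a s IH] H; first by rewrite big_nil expr0 ncC normr1.
rewrite big_cons ncM exprS ler_pM ?exprn_ge0 //.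
  by rewrite nc_sym H ?mem_head.
by apply: IH => z zs; rewrite H // inE zs orbT.
Qed.

Lemma nc_prod_le (x y : C) (s : seq C) : nc (x - y) <= 1 ->
  nc (\prod_(z <- s) (x - z)) <= \prod_(z <- s) (1 + nc (y - z)).
Proof.
move=> xy; elim: s => [|a s IH]; first by rewrite !big_nil ncC normr1.
rewrite !big_cons ncM ler_pM ?nc_ge0 //.
by rewrite (le_trans (nc_triangle _ y _)) // lerD2r.
Qed.

(** If all the roots of the polynomial stay at distance d of a point x, its
    modulus at x is at least d ^ n. The limit polynomial vanishes at y, hence
    is smaller than that at some x near y and outside the exceptional set S. *)
Lemma near_root (T : Type) (F : set_system T) (FF : Filter F) (m : T -> seq C)
    (y : C) (s0 S : seq C) (e : R) : 0 < e ->
  (\forall t \near F, size (m t) = (size s0).+1) ->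
  (forall x, x \notin S ->
    ccvg F (fun t => \prod_(z <- m t) (x - z)) (\prod_(z <- y :: s0) (x - z))) ->
  \forall t \near F, exists2 z, z \in m t & nc (z - y) < e.
Proof.
move=> e0 szm cvgm.
set n := (size s0).+1; set K := \prod_(z <- s0) (1 + nc (y - z)).
have K0 : 0 < K by apply: prodr_gt0 => z _; rewrite ltr_wpDr ?nc_ge0.
set d := e / 2; have d0 : 0 < d by rewrite divr_gt0.
set r := Num.min 1 (Num.min d (d ^+ n / K)).
have r0 : 0 < r by rewrite !lt_min ltr01 d0 divr_gt0 ?exprn_gt0.
pose g (k : nat) : C := y + (r / k.+2%:R)%:C.
have gi : injective g.
  move=> i j /addrI/complexI/(mulfI (lt0r_neq0 r0))/invr_inj/eqP.
  by rewrite eqr_nat => /eqP[].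
(* the points y + r / (k + 2) are infinitely many, and all close to y *)
have [k xS] := inj_avoid S gi.
have xy : nc (g k - y) < r.
  rewrite /g addrC addKr ncC ger0_norm ?divr_ge0 ?ler0n ?ltW //.
  by rewrite ltr_pdivrMr ?ltr0n // ltr_pMr // ltr1n.
move: xy; rewrite /r !lt_min => /and3P[xy1 xyd xyK].
have small : nc (\prod_(z <- y :: s0) (g k - z)) < d ^+ n.
  rewrite big_cons ncM; apply: le_lt_trans (_ : nc (g k - y) * K < _).
    by rewrite ler_wpM2l ?nc_ge0 // nc_prod_le // ltW.
  by rewrite -ltr_pdivlMr.
have /(_ (d ^+ n - nc (\prod_(z <- y :: s0) (g k - z)))) := cvgm _ xS.
rewrite subr_gt0 => /(_ small).
apply: filterS2 szm => t szt close_t.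
apply: contrapT => H.
have far : forall z, z \in m t -> d <= nc (z - g k).
  move=> z zm; rewrite leNgt; apply/negP => zd; apply: H; exists z => //.
  by rewrite (splitr e) (le_lt_trans (nc_triangle _ (g k) _)) // ltrD.
have := nc_prod_ge (ltW d0) far; rewrite szt; apply/negP; rewrite -ltNge.
have := nc_triangle (\prod_(z <- m t) (g k - z))
  (\prod_(z <- y :: s0) (g k - z)) 0.
rewrite !subr0 => /le_lt_trans; apply.
by rewrite -ltrBrDr.
Qed.

(** By induction on the degree: the root of m t closest to y tends to y, and
    dividing by it preserves the pointwise convergence outside y. This is why
    an exceptional set S has to be carried along. *)
Lemma roots_cvg (T : Type) (F : set_system T) (FF : Filter F)
    (s0 : seq C) (m : T -> seq C) (S : seq C) :
  (\forall t \near F, size (m t) = size s0) ->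
  (forall x, x \notin S ->
    ccvg F (fun t => \prod_(z <- m t) (x - z)) (\prod_(z <- s0) (x - z))) ->
  multi_cvg F m s0.
Proof.
elim: s0 m S => [|y s0 IH] m S szm cvgm.
  move=> e e0; apply: filterS szm => t /eqP; rewrite size_eq0 => /eqP->.
  by exists [::].
have /choice[z zP] : forall t, exists z, m t != [::] -> z \in m t /\
    forall z', z' \in m t -> nc (z - y) <= nc (z' - y).
  move=> t; case: (eqVneq (m t) [::]) => [->|/closest_ex -/(_ y)[z z1 z2]].
    by exists 0.
  by exists z.
have mN0 : \forall t \near F, m t != [::].
  by apply: filterS szm => t st; rewrite -size_eq0 st.
have zcvg : ccvg F z y.
  move=> e e0; have := near_root FF e0 szm cvgm.
  apply: filterS2 mN0 => t /zP[_ zmin] [u /zmin um ue].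
  exact: le_lt_trans ue.
have cvgr : multi_cvg F (fun t => rem (z t) (m t)) s0.
  apply: (IH _ (y :: S)).
    apply: filterS2 szm mN0 => t st /zP[zm _].
    by rewrite size_rem // st.
  move=> x; rewrite inE negb_or => /andP[xy xS].
  have xzcvg : ccvg F (fun t => x - z t) (x - y).
    by apply: ccvgB => //; exact: ccvg_cst.
  have xy0 : x - y != 0 by rewrite subr_eq0.
  have := ccvgM FF (cvgm _ xS) (ccvgV FF xy0 xzcvg).
  rewrite big_cons mulrAC divff // mul1r; apply: ccvg_near.
  apply: filterS2 mN0 (ccvg_neq FF xy0 xzcvg) => t /zP[zm _] xz0 /=.
  by rewrite (perm_big _ (perm_to_rem zm)) /= big_cons mulrAC divff ?mul1r.
move=> e e0.
apply: filterS3 mN0 (zcvg _ e0) (cvgr _ e0) => t /zP[zm _] zye [s ps cs].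
exists (z t :: s); last by rewrite /close /= zye.
by rewrite perm_sym (perm_trans (perm_to_rem zm)) // perm_cons perm_sym.
Qed.
End RootsCvg.

(** * Limits of continuous functions with finitely many cluster values *)

Section LimitPoint.
Variable R : realType.
Local Open Scope classical_set_scope.
Local Open Scope ring_scope.
Local Notation nc := (@Normc.normc R).
Local Notation C := R[i].

Lemma gap1_ex (y : C) (s : seq C) : exists2 d : R, 0 < d &
  forall z, z \in s -> z != y -> d <= nc (z - y).
Proof.
elim: s => [|a s [d d0 IH]]; first by exists 1.
case: (eqVneq a y) => [ay|ay].
  by exists d => // z; rewrite inE => /orP[/eqP->|/IH //]; rewrite ay eqxx.
exists (Num.min d (nc (a - y))).
  by rewrite lt_min d0 lt_neqAle eq_sym nc_eq0 nc_ge0 subr_eq0 ay.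
move=> z; rewrite inE ge_min => /orP[/eqP-> _|zs zy]; first by rewrite lexx orbT.
by rewrite IH.
Qed.

Lemma gap_ex (s : seq C) : exists2 d : R, 0 < d &
  forall y z, y \in s -> z \in s -> z != y -> d <= nc (z - y).
Proof.
have /choice[D DP] : forall y : C, exists d : R, 0 < d /\
    forall z, z \in s -> z != y -> d <= nc (z - y).
  by move=> y; have [d d0 H] := gap1_ex y s; exists d.
have [d d0 dP] : exists2 d, 0 < d & forall y, y \in s -> d <= D y.
  elim: (s) => [|a s' [d d0 IH]]; first by exists 1.
  exists (Num.min d (D a)); first by rewrite lt_min d0 (DP a).1.
  move=> y; rewrite inE ge_min => /orP[/eqP->|/IH ->//].
  by rewrite lexx orbT.
exists d => // y z ys zs zy.
exact: le_trans (dP _ ys) ((DP y).2 _ zs zy).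
Qed.

Definition ccont (f : R -> C) (t : R) := ccvg (nbhs t) f (f t).

Lemma ccont_nc (f : R -> C) (y : C) (t : R) : ccont f t ->
  {for t, continuous (fun u => nc (f u - y))}.
Proof.
move=> ft; apply/cvgrPdist_lt => e /ft; apply: filterS => u.
have := nc_triangle (f u) (f t) y; have := nc_triangle (f t) (f u) y.
rewrite (nc_sym (f t) (f u)) distrC => H1 H2; apply: le_lt_trans.
by rewrite ler_norml; apply/andP; split; lra.
Qed.

(** When the cluster values are isolated, a continuous function cannot pass
    from one to another inside an interval: its distance to the first one would
    take an intermediate value. The first hypothesis on F says that F is
    generated by intervals; it holds at one-sided limits and along an interval
    at one of its ends. *)
Lemma limit_point (F : set_system R) (FF : ProperFilter F) (f : R -> C)
    (s : seq C) :
  (forall A, F A -> exists B, [/\ F B, B `<=` A, is_interval B &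
     forall t, B t -> ccont f t]) ->
  (forall e : R, 0 < e -> \forall t \near F, exists2 y, y \in s & nc (f t - y) < e) ->
  exists2 y, y \in s & ccvg F f y.
Proof.
move=> basis fs; have [d d0 dP] := gap_ex s.
(* half of a lower bound for the distances in s: no value of f within e of one
   point is at distance exactly e of another *)
pose e := d / 2; have e0 : 0 < e by rewrite divr_gt0.
have [B [FB BA Bint Bcont]] := basis _ (fs _ e0).
have [t1 Bt1] := filter_ex FB.
have [y ys yt1] := BA _ Bt1.
have uniqy z t : B t -> z \in s -> nc (f t - z) < e -> nc (f t - y) <= e -> z = y.
  move=> Bt zs ztc ytc; apply/eqP/negP => /negP zy.
  have := dP _ _ ys zs zy; rewrite leNgt => /negP; apply.
  apply: le_lt_trans (nc_triangle _ (f t) _) _.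
  by rewrite [ltRHS](splitr d) ltr_leD // nc_sym.
have near_y t : B t -> nc (f t - y) < e.
  move=> Bt; rewrite ltNge; apply/negP => yt.
  have ivt a b : a <= b -> B a -> B b ->
      Num.min (nc (f a - y)) (nc (f b - y)) <= e
        <= Num.max (nc (f a - y)) (nc (f b - y)) -> False.
    move=> ab Ba Bb /(@IVT _ (fun u => nc (f u - y)) _ _ _ ab)[].
      apply: continuous_in_subspaceT => u; rewrite inE/= in_itv /= => uab.
      by apply: ccont_nc; apply: Bcont; exact: (Bint a b).
    move=> c; rewrite in_itv /= => cab ce.
    have Bc : B c by exact: (Bint a b).
    have [z zs zc] := BA _ Bc.
    have zy := uniqy _ _ Bc zs zc; rewrite ce lexx in zy.
    by move: zc; rewrite zy // ce ltxx.
  have [tt1|/ltW t1t] := leP t t1.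
    by apply: (ivt _ _ tt1 Bt Bt1); rewrite ge_min le_max (ltW yt1) yt orbT.
  by apply: (ivt _ _ t1t Bt1 Bt); rewrite ge_min le_max (ltW yt1) yt orbT.
exists y => // r r0.
have m0 : 0 < Num.min r e by rewrite lt_min r0 e0.
apply: filterS2 FB (fs _ m0) => t Bt [z zs]; rewrite lt_min => /andP[zr ze].
by rewrite -(uniqy _ _ Bt zs ze) // ltW // near_y.
Qed.
End LimitPoint.

(** * Continuous selections of unordered families *)

Section Selection.
Variable R : realType.
Local Open Scope classical_set_scope.
Local Open Scope ring_scope.
Local Notation nc := (@Normc.normc R).
Local Notation C := R[i].
Implicit Types (s : seq C) (m l : R -> seq C) (J K U : set R).

Lemma close_size e s s' : close e s s' -> size s = size s'.
Proof. by rewrite /close all2E => /andP[/eqP]. Qed.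

Lemma close_le e e' s s' : e <= e' -> close e s s' -> close e' s s'.
Proof.
move=> ee'; elim: s s' => [|x s IH] [|y s'] //= /andP[xy /IH].
by rewrite /close /= => ->; rewrite (lt_le_trans xy ee').
Qed.

Lemma close_memr e s s' y : close e s s' -> y \in s' ->
  exists2 z, z \in s & nc (z - y) < e.
Proof.
elim: s s' => [|x s IH] [|y' s'] //= /andP[xy /IH H].
rewrite inE => /orP[/eqP->|/H[z zs zy]]; first by exists x; rewrite ?mem_head.
by exists z; rewrite // inE zs orbT.
Qed.

Lemma close_meml e s s' z : close e s s' -> z \in s ->
  exists2 y, y \in s' & nc (z - y) < e.
Proof.
elim: s s' => [|x s IH] [|y' s'] //= /andP[xy /IH H].
rewrite inE => /orP[/eqP->|/H[y zs zy]]; first by exists y'; rewrite ?mem_head.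
by exists y; rewrite // inE zs orbT.
Qed.

Lemma close_filter (P : pred C) e s s' :
  (forall z y, y \in s' -> nc (z - y) < e -> P z = P y) ->
  close e s s' -> close e [seq x <- s | P x] [seq x <- s' | P x].
Proof.
elim: s s' => [|x s IH] [|y s'] //= H /andP[xy ss'].
rewrite (H x y) ?mem_head //.
have {}IH : close e [seq x <- s | P x] [seq x <- s' | P x].
  by apply: IH => // z y' y's'; apply: H; rewrite inE y's' orbT.
by case: ifP => _ //; rewrite /close /= xy.
Qed.

(** A function rd that rounds to the nearest point of s' identifies two
    families that are close to s' entry by entry. *)
Lemma close_map (rd : C -> C) e s s' :
  (forall z y, y \in s' -> nc (z - y) < e -> rd z = y) ->
  close e s s' -> map rd s = s'.
Proof.
elim: s s' => [|x s IH] [|y s'] //= H /andP[xy ss'].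
rewrite (H x y) ?mem_head // (IH s') // => z y' y's'; apply: H.
by rewrite inE y's' orbT.
Qed.

Definition mcont m (t : R) := multi_cvg (nbhs t) m (m t).

(** The selection l orders the family m continuously; continuity at a point of
    J is meant in the ambient line, which is harmless for open J. *)
Definition sel J m l := forall t, J t ->
  perm_eq (l t) (m t) /\ forall i, ccont (fun u => (l u)`_i) t.

Definition selectable n := forall J m, open J -> is_interval J ->
  (forall t, J t -> size (m t) = n) -> (forall t, J t -> mcont m t) ->
  exists l, sel J m l.

Lemma ccont_near (f g : R -> C) t :
  (\forall u \near nbhs t, f u = g u) -> ccont f t -> ccont g t.
Proof.
move=> fg; rewrite /ccont -(nbhs_singleton fg) => ft.
by apply: ccvg_near ft.
Qed.

Lemma sel_sub J K m l : K `<=` J -> sel J m l -> sel K m l.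
Proof. by move=> KJ H t /KJ; apply: H. Qed.

(** A fixed permutation of the entries preserves continuity, so a selection may
    be given any prescribed order at one point. *)
Lemma sel_reorder n J m l s e : (forall t, J t -> size (m t) = n) ->
  sel J m l -> J e -> perm_eq s (m e) ->
  exists2 l', sel J m l' & l' e = s.
Proof.
move=> szm lJ Je sme.
have : perm_eq s (l e) by rewrite (perm_trans sme) // perm_sym (lJ e Je).1.
move=> /(perm_iotaP 0)[Is]; rewrite (perm_size (lJ e Je).1) szm // => pIs sE.
exists (fun t => [seq (l t)`_i | i <- Is]) => // t Jt.
have szl : size (l t) = n by rewrite (perm_size (lJ t Jt).1) szm.
split=> [|i].
  apply: perm_trans (lJ t Jt).1; apply/(perm_iotaP 0).
  by exists Is; rewrite // szl.
have [iIs|iIs] := ltnP i (size Is).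
  apply: ccont_near ((lJ t Jt).2 (nth 0%N Is i)).
  by apply: filterE => u; rewrite (nth_map 0%N).
apply: (@ccont_near (fun=> 0)); last exact: ccvg_cst.
by apply: filterE => u; rewrite nth_default // size_map.
Qed.

(** Each branch of l has its cluster values among the entries of s0, hence
    converges; that the limits list s0 with the right multiplicities follows by
    rounding both l t and a listing of m t close to s0. *)
Lemma sel_limit n J m l (F : set_system R) (FF : ProperFilter F) s0 :
  (forall A, F A -> exists B, [/\ F B, B `<=` A, B `<=` J & is_interval B]) ->
  (forall t, J t -> size (m t) = n) -> sel J m l ->
  size s0 = n -> multi_cvg F m s0 ->
  exists2 s, perm_eq s s0 & forall i, ccvg F (fun t => (l t)`_i) s`_i.
Proof.
move=> basis szm lJ sz0 ms0.
have FJ : F J.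
  by have [B [FB _ BJ _]] := basis _ filterT; apply: filterS FB.
have /choice[y yP] : forall i, exists y, (i < n)%N ->
    y \in s0 /\ ccvg F (fun t => (l t)`_i) y.
  move=> i; case: (ltnP i n) => [ltin|]; last by exists 0.
  suff [y ys0 yi] : exists2 y, y \in s0 & ccvg F (fun t => (l t)`_i) y.
    by exists y.
  apply: limit_point => [A /basis[B [FB BA BJ Bint]]|e e0].
    by exists B; split=> // t /BJ Jt; exact: (lJ t Jt).2.
  apply: filterS2 FJ (ms0 _ e0) => t Jt [s ps cs].
  have : (l t)`_i \in s.
    rewrite (perm_mem ps) -(perm_mem (lJ t Jt).1) mem_nth //.
    by rewrite (perm_size (lJ t Jt).1) szm.
  by move=> /(close_meml cs).
exists (mkseq y n); last first.
  move=> i; case: (ltnP i n) => [ltin|lein].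
    by rewrite nth_mkseq //; exact: (yP i ltin).2.
  rewrite nth_default ?size_mkseq //.
  apply: ccvg_near (ccvg_cst _ 0); apply: filterS FJ => t Jt.
  by rewrite nth_default // (perm_size (lJ t Jt).1) szm.
have [d d0 dP] := gap_ex s0; pose e := d / 2.
have e0 : 0 < e by rewrite divr_gt0.
(* rd rounds to the unique point of s0 at distance less than e *)
have /choice[rd rdP] : forall z, exists y, forall y', y' \in s0 ->
    nc (z - y') < e -> y = y'.
  move=> z; have [[x [xs xz]]|H] := pselect (exists x, x \in s0 /\ nc (z - x) < e).
    exists x => y' y's y'z; apply/eqP/negP => /negP xy'.
    have := dP _ _ y's xs xy'; rewrite leNgt => /negP; apply.
    by rewrite (le_lt_trans (nc_triangle _ z _)) // (splitr d) ltrD // nc_sym.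
  by exists 0 => x xs xz; exfalso; apply: H; exists x.
have near_all : \forall t \near F, forall i, (i < n)%N -> nc ((l t)`_i - y i) < e.
  have : forall k, (k <= n)%N ->
      \forall t \near F, forall i, (i < k)%N -> nc ((l t)`_i - y i) < e.
    elim=> [|k IH] kn; first by apply: filterE.
    apply: filterS2 (IH (ltnW kn)) ((yP k kn).2 _ e0) => t H1 H2 i.
    by rewrite ltnS leq_eqVlt => /orP[/eqP->|/H1].
  by move=> /(_ n (leqnn n)).
have [t [Jt [nt [s ps cs]]]] :=
  @filter_ex _ _ FF _ (filterI FJ (filterI near_all (ms0 _ e0))) .
have sE : map rd s = s0.
  by apply: close_map cs => z y' y's0 zy'; exact: rdP.
have lE : map rd (l t) = mkseq y n.
  apply: (@eq_from_nth _ 0); rewrite size_map (perm_size (lJ t Jt).1) szm //.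
    by rewrite size_mkseq.
  move=> i ltin; rewrite nth_mkseq // (nth_map 0); last first.
    by rewrite (perm_size (lJ t Jt).1) szm.
  by apply: rdP (nt _ ltin); exact: (yP i ltin).1.
suff : perm_eq (map rd (l t)) (map rd s) by rewrite lE sE.
by apply: perm_map; rewrite (perm_trans (lJ t Jt).1) // perm_sym.
Qed.

Definition nonconst s := exists x y, [/\ x \in s, y \in s & x != y].

Lemma ball_interval (x e : R) : is_interval (ball x e).
Proof.
move=> a b; rewrite /ball /= => xa xb z /andP[az zb].
by move: xa xb; rewrite !ltr_norml => /andP[H1 H2] /andP[H3 H4]; apply/andP; split; lra.
Qed.

Lemma ball_open_R (x e : R) : open (ball x e).
Proof. exact: ball_open. Qed.

(** Near a point where two values differ, the values close to the first one and
    the other ones form two smaller families, each continuous, to which the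
    induction hypothesis applies. *)
Lemma split_local n J m t0 : (forall k, (k < n)%N -> selectable k) ->
  open J -> (forall t, J t -> size (m t) = n) -> (forall t, J t -> mcont m t) ->
  J t0 -> nonconst (m t0) ->
  exists U, [/\ open U, is_interval U, U t0, U `<=` J & exists l, sel U m l].
Proof.
move=> IH oJ szm mc Jt0 [x [y [xm ym xy]]].
have [d d0 dP] := gap1_ex x (m t0).
pose e := d / 4; have e0 : 0 < e by rewrite divr_gt0.
pose P := fun z : C => nc (z - x) < d / 2.
(* no value of the family near t0 lies at distance between e and 3 e of x *)
have PE z y' : y' \in m t0 -> nc (z - y') < e ->
    (nc (z - x) < e) || (3 * e <= nc (z - x)).
  move=> y'm zy'; case: (eqVneq y' x) => [<-|y'x]; first by rewrite zy'.
  apply/orP; right; have := dP _ y'm y'x; have := nc_triangle y' z x.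
  rewrite (nc_sym y' z) /e in zy' *; lra.
have : nbhs t0 (J `&` [set t | exists2 s, perm_eq s (m t) & close e s (m t0)]).
  by apply: filterI; [exact: open_nbhs_nbhs|exact: mc].
move=> /nbhs_ballP[r /= r0 rP].
pose U := ball t0 r.
have UJ : U `<=` J by move=> t /rP[].
have mU t z : U t -> z \in m t -> (nc (z - x) < e) || (3 * e <= nc (z - x)).
  move=> /rP[_ [s ps cs]]; rewrite -(perm_mem ps) => /(close_meml cs)[y' y'm].
  exact: PE.
have PPE t z z' : U t -> z' \in m t -> nc (z - z') < e -> P z = P z'.
  move=> Ut /(mU _ _ Ut) z'm zz'; rewrite /P.
  have := nc_triangle z z' x; have := nc_triangle z' z x.
  rewrite (nc_sym z' z); move: zz' z'm; rewrite /e => zz' /orP[] H H1 H2.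
    have -> : nc (z' - x) < d / 2 by lra.
    by lra.
  have -> : (nc (z' - x) < d / 2) = false by apply/negbTE; rewrite -leNgt; lra.
  by apply/negbTE; rewrite -leNgt; lra.
have Ut0 : U t0 by exact: ballxx.
have sub (Q : pred C) : (forall t z z', U t -> z' \in m t ->
      nc (z - z') < e -> Q z = Q z') -> (count Q (m t0) < n)%N ->
    exists2 l, sel U (fun t => [seq z <- m t | Q z]) l &
      (forall t, U t -> size (l t) = count Q (m t0)).
  move=> QE /IH; move=> /(_ U (fun t => [seq z <- m t | Q z])) [].
  - exact: ball_open_R.
  - exact: ball_interval.
  - move=> t Ut; have [_ [s ps cs]] := rP _ Ut.
    rewrite -(perm_size (perm_filter Q ps)) -size_filter.
    by apply: (@close_size e); apply: close_filter => // z z'; exact: QE.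
  - move=> t Ut e' e'0.
    have m0 : 0 < Num.min e' e by rewrite lt_min e'0.
    apply: filterS (mc _ (UJ _ Ut) _ m0) => u [s ps cs].
    exists [seq z <- s | Q z]; first by apply: perm_filter.
    apply: (@close_le (Num.min e' e)); first by rewrite ge_min lexx.
    apply: close_filter cs => z z' z'm; rewrite lt_min => /andP[_].
    exact: QE z'm.
  - move=> l lU; exists l => // t Ut.
    have [_ [s ps cs]] := rP _ Ut.
    rewrite (perm_size (lU t Ut).1) -(perm_size (perm_filter Q ps)) -size_filter.
    by apply: (@close_size e); apply: close_filter => // z z'; exact: QE.
have Px : P x by rewrite /P subrr nc0 divr_gt0.
have Py : ~~ P y.
  by rewrite /P -leNgt; have := dP y ym; rewrite eq_sym xy => /(_ isT); lra.
have cPC : (count P (m t0) + count (predC P) (m t0) = n)%N.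
  by rewrite count_predC szm.
have [l1 l1U sz1] : exists2 l, sel U (fun t => [seq z <- m t | P z]) l &
      (forall t, U t -> size (l t) = count P (m t0)).
  apply: sub => //; rewrite -[ltnRHS]cPC -[ltnLHS]addn0 ltn_add2l -has_count.
  by apply/hasP; exists y.
have [l2 l2U sz2] : exists2 l, sel U (fun t => [seq z <- m t | predC P z]) l &
      (forall t, U t -> size (l t) = count (predC P) (m t0)).
  apply: sub => [t z z' Ut z'm zz'|]; first by rewrite /= (PPE _ _ _ Ut z'm).
  rewrite -[ltnRHS]cPC -[ltnLHS]add0n ltn_add2r -has_count.
  by apply/hasP; exists x.
exists U; split=> //; [exact: ball_open_R|exact: ball_interval|].
exists (fun t => l1 t ++ l2 t) => t Ut; split=> [|i].
  apply: perm_trans (perm_cat (l1U t Ut).1 (l2U t Ut).1) _.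
  exact: permEl (perm_filterC P (m t)).
have nU : \forall u \near nbhs t, U u.
  by apply: open_nbhs_nbhs; split=> //; exact: ball_open_R.
case: (ltnP i (count P (m t0))) => ltiP.
  apply: ccont_near ((l1U t Ut).2 i); apply: filterS nU => u Uu.
  by rewrite nth_cat sz1 // ltiP.
apply: ccont_near ((l2U t Ut).2 (i - count P (m t0))%N).
apply: filterS nU => u Uu.
by rewrite nth_cat sz1 // ltnNge ltiP.
Qed.

End Selection.

Section Gluing.
Variable R : realType.
Local Open Scope classical_set_scope.
Local Open Scope ring_scope.
Local Notation nc := (@Normc.normc R).
Local Notation C := R[i].
Implicit Types (s : seq C) (m l : R -> seq C) (J K U : set R).

(** An end e of an interval K is its only boundary point on that side, so a
    point t outside K that is closer to e than r is has a neighbourhood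
    disjoint from K. *)
Lemma boundary_side K (r e t : R) : is_interval K -> K r -> closure K e ->
  ~ K e -> `|e - t| < `|e - r| -> ~ K t -> t != e ->
  \forall u \near nbhs t, ~ K u.
Proof.
move=> Ki Kr Ke nKe te nKt; rewrite neq_lt => /orP[tlt|tgt].
  have [re|er|re] := ltgtP r e; last by rewrite -re in nKe.
    have rt : r < t.
      by move: te; rewrite !gtr0_norm ?subr_gt0 // ltrD2l ltrN2.
    have nt : nbhs e [set u | t < u] by exact: lt_nbhsr.
    have [u [Ku /= tu]] := Ke _ nt.
    by exfalso; apply: nKt; apply: (Ki _ _ Kr Ku); rewrite !ltW.
  have nt : nbhs t [set u | u < e] by exact: lt_nbhsl.
  apply: filterS nt => u /= ue Ku; apply: nKe.
  by apply: (Ki _ _ Ku Kr); rewrite !ltW.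
have [re|er|re] := ltgtP r e; last by rewrite -re in nKe.
  have nt : nbhs t [set u | e < u] by exact: lt_nbhsr.
  apply: filterS nt => u /= ue Ku; apply: nKe.
  by apply: (Ki _ _ Kr Ku); rewrite !ltW.
have rt : t < r.
  by move: te; rewrite !ltr0_norm ?subr_lt0 // ltrN2 ltrD2l ltrN2.
have nt : nbhs e [set u | u < t] by exact: lt_nbhsl.
have [u [Ku /= tu]] := Ke _ nt.
by exfalso; apply: nKt; apply: (Ki _ _ Ku Kr); rewrite !ltW.
Qed.

Lemma interval_setI J K : is_interval J -> is_interval K -> is_interval (J `&` K).
Proof.
by move=> Ji Ki x y [Jx Kx] [Jy Ky] z xzy; split; [exact: (Ji x y)|exact: (Ki x y)].
Qed.

(** A selection over K has a limit at an end e of K inside J, and a local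
    selection around e can be reordered to agree with that limit. *)
Lemma sel_extend n J m (r : R) K l :
  (forall t, J t -> size (m t) = n) -> (forall t, J t -> mcont m t) ->
  (forall t, J t -> exists U, [/\ open U, is_interval U, U t, U `<=` J &
     exists l, sel U m l]) ->
  is_interval J -> open J -> open K -> is_interval K -> K r -> K `<=` J ->
  sel K m l -> K <> J ->
  exists K' l', [/\ open K', is_interval K', K `<=` K', K' `<=` J & sel K' m l'] /\
    ~ (K' `<=` K) /\ forall t, K t -> l' t = l t.
Proof.
move=> szm mc loc Ji oJ oK Ki Kr KJ lK KnJ.
have [e [Je Ke nKe]] : exists e, [/\ J e, closure K e & ~ K e].
  apply: contrapT => H; apply: KnJ.
  have /connected_intervalP Jc := Ji.
  apply: Jc; first by exists r.
    by exists K => //; rewrite setIidr.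
  exists (closure K); first exact: closed_closure.
  rewrite eqEsubset; split=> [t Kt|t [Jt Kt]].
    by split; [exact: KJ|exact: subset_closure].
  by apply: contrapT => nKt; apply: H; exists t.
have er0 : 0 < `|e - r|.
  by rewrite normr_gt0 subr_eq0; apply: contra_notN nKe => /eqP->.
have [U0 [oU0 U0i U0e U0J [l0 l0U0]]] := loc _ Je.
(* small enough for [boundary_side], with the given point r of K *)
pose U := U0 `&` ball e `|e - r|.
have oU : open U by apply: openI => //; exact: ball_open.
have Ui : is_interval U by apply: interval_setI => //; exact: ball_interval.
have Ue : U e by split=> //; exact: ballxx.
have UJ : U `<=` J by move=> t [/U0J].
have l0U : sel U m l0 by apply: sel_sub l0U0 => t [].
have nU : nbhs e U by exact: open_nbhs_nbhs.
pose F := within K (nbhs e).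
have FF : ProperFilter F.
  split; last exact: within_filter.
  move=> H; have [u [Ku /(_ Ku)]] := Ke _ H.
  by [].
have mF : multi_cvg F m (m e).
  move=> d d0; have := mc _ Je _ d0.
  by apply: filterS => u H _.
have basis A : F A -> exists B, [/\ F B, B `<=` A, B `<=` K & is_interval B].
  move=> /nbhs_ballP[d /= d0 dA]; exists (K `&` ball e d); split.
  - by apply/nbhs_ballP; exists d => //= u eu Ku; split.
  - by move=> u [Ku eu]; exact: dA.
  - by move=> u [].
  - by apply: interval_setI => //; exact: ball_interval.
have [s ps ls] := sel_limit FF basis (fun t Kt => szm t (KJ t Kt)) lK (szm _ Je) mF.
have [l1 l1U l1e] := sel_reorder (fun t Ut => szm t (UJ t Ut)) l0U Ue ps.
exists (K `|` U), (fun t => if `[< K t >] then l t else l1 t).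
split; last first.
  split; last by move=> t Kt; rewrite asboolT.
  by move=> /(_ e); apply/not_implyP; split=> //; right.
split.
- exact: openU.
- apply/connected_intervalP/connectedU; try exact/connected_intervalP.
  exact: Ke _ nU.
- by move=> t; left.
- by move=> t [/KJ|/UJ].
move=> t KUt; split; first by case: asboolP KUt => [/lK[]//|nKt [//|/l1U[]]].
move=> i; case: (pselect (K t)) => [Kt|nKt].
  have nK : nbhs t K by exact: open_nbhs_nbhs.
  apply: ccont_near ((lK t Kt).2 i); apply: filterS nK => u Ku.
  by rewrite asboolT.
have Ut : U t by case: KUt.
case: (eqVneq t e) => [te|te].
  rewrite te /ccont asboolF // => d d0.
  have l1i := (l1U e Ue).2 i; rewrite /ccont l1e in l1i *.
  apply: filterS2 (l1i _ d0) (ls i _ d0) => u H1 H2.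
  by case: asboolP => [/H2|].
have nK : \forall u \near nbhs t, ~ K u.
  by apply: (boundary_side Ki Kr Ke nKe _ nKt te); case: Ut.
apply: ccont_near ((l1U t Ut).2 i); apply: filterS nK => u nKu.
by rewrite asboolF.
Qed.

(** Zorn's lemma on selections over open intervals containing a given point; by
    [sel_extend] a maximal one is defined on all of J. *)
Lemma sel_global n J m : is_interval J -> open J ->
  (forall t, J t -> size (m t) = n) -> (forall t, J t -> mcont m t) ->
  (forall t, J t -> exists U, [/\ open U, is_interval U, U t, U `<=` J &
     exists l, sel U m l]) ->
  exists l, sel J m l.
Proof.
move=> Ji oJ szm mc loc.
have [[r Jr]|J0] := pselect (exists r, J r); last first.
  by exists m => t Jt; exfalso; apply: J0; exists t.
pose good (p : set R * (R -> seq C)) :=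
  [/\ open p.1, is_interval p.1, p.1 r, p.1 `<=` J & sel p.1 m p.2].
pose T := {p | good p}.
have [U [oU Ui Ur UJ [l0 l0U]]] := loc _ Jr.
pose t0 : T := exist good (U, l0) (And5 oU Ui Ur UJ l0U).
pose ext (p q : T) : bool := `[< (sval p).1 `<=` (sval q).1 /\
  forall t, (sval p).1 t -> (sval q).2 t = (sval p).2 t >].
have [//|||[[K l] [/= oK Ki Kr KJ lK]] max] := @ZL_preorder T t0 ext.
- by move=> p; apply/asboolP; split.
- move=> p q s /asboolP[pq pqE] /asboolP[qs qsE]; apply/asboolP; split.
    exact: subset_trans qs.
  by move=> t pt; rewrite qsE ?pqE //; exact: pq.
- move=> A Atot.
  have [[p0 Ap0]|A0] := pselect (exists p, A p); last first.
    by exists t0 => s As; exfalso; apply: A0; exists s.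
  pose K := [set t | exists2 p : T, A p & (sval p).1 t].
  have /choice[pk pkP] : forall t, exists p : T, K t -> A p /\ (sval p).1 t.
    move=> t; have [[p Ap pt]|nK] := pselect (K t); first by exists p.
    by exists t0.
  pose l t := (sval (pk t)).2 t.
  have lE (q : T) t : A q -> (sval q).1 t -> l t = (sval q).2 t.
    move=> Aq qt; have [|Ap pt] := pkP t; first by exists q.
    by have [/asboolP[_ H]|/asboolP[_ H]] := Atot _ _ Ap Aq; rewrite /l H.
  have nK (q : T) t : A q -> (sval q).1 t ->
      \forall u \near nbhs t, (sval q).1 u.
    by case: q => q [oq *]; exact: open_nbhs_nbhs.
  have gK : good (K, l).
    split=> /=.
    - rewrite openE => t [p Ap pt]; apply: filterS (nK _ _ Ap pt) => u pu.
      by exists p.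
    - move=> x y [p Ap px] [q Aq qy] z xyz.
      have [/asboolP[pq _]|/asboolP[qp _]] := Atot _ _ Ap Aq.
        exists q => //; case: q {Aq} qy pq => q [/= _ qi _ _ _] qy pq.
        by apply: (qi x y) => //; exact: pq.
      exists p => //; case: p {Ap} px qp => p [/= _ qi _ _ _] px pq.
      by apply: (qi x y) => //; exact: pq.
    - by exists p0 => //; case: p0 {Ap0} => p [].
    - by move=> t [[p [/= _ _ _ pJ _]] _ /= /pJ].
    - move=> t [p Ap pt].
      have [selt contt] : perm_eq ((sval p).2 t) (m t) /\
          forall i, ccont (fun u => ((sval p).2 u)`_i) t.
        by case: p {Ap} pt => p [/= _ _ _ _ sp] /sp.
      rewrite (lE _ _ Ap pt); split=> // i.
      apply: ccont_near (contt i); apply: filterS (nK _ _ Ap pt) => u pu.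
      by rewrite (lE p).
  exists (exist good (K, l) gK) => s As; apply/asboolP; split=> /=.
    by move=> t st; exists s.
  by move=> t st; rewrite (lE s).
have [<-|KnJ] := pselect (K = J); first by exists l.
have [K' [l' [[oK' K'i KK' K'J l'K'] [nK' El]]]] :=
  sel_extend szm mc loc Ji oJ oK Ki Kr KJ lK KnJ.
exfalso; apply: nK'.
have := max (exist good (K', l') (And5 oK' K'i (KK' _ Kr) K'J l'K')).
have H : `[< K `<=` K' /\ (forall t, K t -> l' t = l t) >] by apply/asboolP.
by move=> /(_ H) /asboolP[].
Qed.

(** On the open set U where the values do not all agree, use [split_local] and
    glue over each component of U. Where they agree any ordering is continuous,
    since every listing of a nearby family is close to the constant one. *)
Theorem continuous_selection n : selectable R n.
Proof.
elim/ltn_ind: n => n IH J m oJ Ji szm mc.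
pose U := [set t | J t /\ nonconst (m t)].
have oU : open U.
  rewrite openE => t [Jt [x [y [xm ym xy]]]].
  pose e := nc (x - y) / 2.
  have e0 : 0 < e by rewrite divr_gt0 // lt_neqAle eq_sym nc_eq0 subr_eq0 xy nc_ge0.
  have nJ : nbhs t J by exact: open_nbhs_nbhs.
  apply: filterS2 nJ (mc _ Jt _ e0) => u Ju [s ps cs]; split=> //.
  have [x' x's xx'] := close_memr cs xm; have [y' y's yy'] := close_memr cs ym.
  exists x', y'; rewrite -!(perm_mem ps); split=> //.
  apply: contraTneq yy' => <-; rewrite -leNgt.
  by have := nc_triangle x x' y; rewrite (nc_sym x x') /e in xx' *; lra.
(* the component of t in U, as the union of the open intervals around t inside
   U *)
pose comp (t : R) : set R := \bigcup_(V in [set V : set R | [/\ open V, is_interval V, V t & V `<=` U]]) V.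
have compo t : open (comp t) by apply: bigcup_open => V [].
have compi t : is_interval (comp t).
  apply/connected_intervalP; apply: bigcup_connected; first by exists t => V [].
  by move=> V [_ Vi _ _]; exact/connected_intervalP.
have compU t : comp t `<=` U by move=> u [V [_ _ _ VU] /VU].
have compt t : U t -> comp t t.
  move=> Ut; have : nbhs t U by exact: open_nbhs_nbhs.
  move=> /nbhs_ballP[d /= d0 dU]; exists (ball t d); last exact: ballxx.
  split=> //; [exact: ball_open|exact: ball_interval|exact: ballxx].
have compS t u : comp t u -> comp t `<=` comp u.
  by move=> tu v tv; exists (comp t).
have compE t u : comp t u -> comp u = comp t.
  move=> tu; rewrite eqEsubset; split; last exact: compS.
  apply: (compS u t); apply: (compS t u tu); apply: compt.
  by case: tu => V [_ _ Vt VU] _; exact: VU.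
have sel_comp t : U t -> exists l, sel (comp t) m l.
  move=> Ut; have compJ : comp t `<=` J by move=> u /compU[].
  apply: (sel_global (n := n)) => //.
  - by move=> u /compJ /szm.
  - by move=> u /compJ /mc.
  move=> u tu.
  have [V [oV Vi Vu VU lV]] : exists V : set R, [/\ open V, is_interval V, V u, V `<=` comp t &
      exists l, sel V m l].
    apply: (split_local (n := n) IH) => //.
    - by move=> v /compJ /szm.
    - by move=> v /compJ /mc.
    - by case: (compU _ _ tu).
  by exists V; split.
have /choice[L LP] : forall K : set R, exists l, (exists2 t, U t & K = comp t) ->
    sel K m l.
  move=> K; have [[t Ut ->]|H] := pselect (exists2 t, U t & K = comp t).
    by have [l lP] := sel_comp _ Ut; exists l.
  by exists m => /H.
have LU t : U t -> sel (comp t) m (L (comp t)) by move=> Ut; apply: LP; exists t.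
exists (fun t => if `[< U t >] then L (comp t) t else m t) => t Jt.
have perm_l u : J u ->
    perm_eq (if `[< U u >] then L (comp u) u else m u) (m u).
  by case: asboolP => [Uu|//] Ju; exact: (LU _ Uu _ (compt _ Uu)).1.
split; first exact: perm_l.
move=> i; case: (pselect (U t)) => [Ut|nUt].
  have ntc : nbhs t (comp t) by apply: open_nbhs_nbhs; split=> //; exact: compt.
  apply: ccont_near ((LU _ Ut _ (compt _ Ut)).2 i).
  apply: filterS ntc => u tu.
  by rewrite asboolT ?(compE t u) //; exact: compU tu.
rewrite /ccont asboolF // => e e0.
have nJ : nbhs t J by exact: open_nbhs_nbhs.
apply: filterS2 nJ (mc _ Jt _ e0) => u Ju [s ps cs].
have pl := perm_l _ Ju.
set lu := if _ then _ else _ in pl *.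
have szl : size lu = n by rewrite (perm_size pl) szm.
have [ltin|lein] := ltnP i n; last first.
  by rewrite !nth_default ?szl ?szm // subrr nc0.
have : lu`_i \in s by rewrite (perm_mem ps) -(perm_mem pl) mem_nth ?szl.
move=> /(close_meml cs)[y ym].
suff -> : (m t)`_i = y by [].
apply: contrapT => /eqP H; apply: nUt; split=> //.
by exists (m t)`_i, y; split=> //; rewrite mem_nth ?szm.
Qed.

End Gluing.

(** * Determinants of partially diagonal pencils *)

Section Determinants.
Local Open Scope ring_scope.

(** Two enumerations of the same index set differ by a permutation, whose sign
    appears twice. *)
Lemma det_mxsub_same_image (S : comPzRingType) m m' n (f : 'I_m -> 'I_n)
    (f' : 'I_m' -> 'I_n) (M : 'M[S]_n) :
  m = m' -> injective f -> (forall i, exists j, f i = f' j) ->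
  \det (mxsub f f M) = \det (mxsub f' f' M).
Proof.
move=> mm'; subst m' => finj fim.
have [g gP] : exists g : 'I_m -> 'I_m, forall i, f i = f' (g i).
  exists (fun i => odflt i [pick j | f i == f' j]) => i.
  case: pickP => [j /eqP//|H]; have [j fij] := fim i.
  by have := H j; rewrite fij eqxx.
have ginj : injective g by move=> i j gij; apply: finj; rewrite !gP gij.
pose s := perm ginj.
have -> : mxsub f f M = row_perm s (col_perm s (mxsub f' f' M)).
  by apply/matrixP => i j; rewrite !mxE !permE !gP.
rewrite row_permE col_permE !det_mulmx !det_perm odd_permV.
by rewrite mulrCA -expr2 sqrr_sign mulr1.
Qed.

Definition enum_cat n (C D : {set 'I_n}) (i : 'I_(#|C| + #|D|)) : 'I_n :=
  match fintype.split i with inl a => enum_val a | inr b => enum_val b end.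

Lemma enum_catl n (C D : {set 'I_n}) i :
  enum_cat (lshift #|D| i : 'I_(#|C| + #|D|)) = enum_val i.
Proof. by rewrite /enum_cat (unsplitK (inl i)). Qed.

Lemma enum_catr n (C D : {set 'I_n}) i :
  enum_cat (rshift #|C| i : 'I_(#|C| + #|D|)) = enum_val i.
Proof. by rewrite /enum_cat (unsplitK (inr i)). Qed.

Lemma enum_cat_inj n (C D : {set 'I_n}) : [disjoint C & D] ->
  injective (@enum_cat n C D).
Proof.
move=> dCD i j; rewrite -(fintype.splitK i) -(fintype.splitK j).
case: (fintype.split i) (fintype.split j) => a [] b /=; rewrite ?enum_catl ?enum_catr.
- by move=> /enum_val_inj ->.
- move=> ab; have := disjointFr dCD (enum_valP a); rewrite ab.
  by rewrite (enum_valP b).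
- move=> ab; have := disjointFr dCD (enum_valP b); rewrite -ab.
  by rewrite (enum_valP a).
- by move=> /enum_val_inj ->.
Qed.

Lemma mxsub_enum_cat (S : Type) n (C D : {set 'I_n}) (M : 'M[S]_n) :
  mxsub (@enum_cat n C D) (@enum_cat n C D) M =
  block_mx (mxsub (@enum_val _ (mem C)) (@enum_val _ (mem C)) M)
           (mxsub (@enum_val _ (mem C)) (@enum_val _ (mem D)) M)
           (mxsub (@enum_val _ (mem D)) (@enum_val _ (mem C)) M)
           (mxsub (@enum_val _ (mem D)) (@enum_val _ (mem D)) M).
Proof.
apply/matrixP => i j; rewrite -(fintype.splitK i) -(fintype.splitK j) mxE.
case: (fintype.split i) (fintype.split j) => a [] b /=;
  by rewrite ?enum_catl ?enum_catr ?block_mxEul ?block_mxEur ?block_mxEdl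
     ?block_mxEdr mxE.
Qed.

Lemma det_sub_union (S : comPzRingType) n (C D : {set 'I_n}) (M : 'M[S]_n) :
  [disjoint C & D] ->
  \det (mxsub (@enum_val _ (mem (C :|: D))) (@enum_val _ (mem (C :|: D))) M) =
  \det (block_mx (mxsub (@enum_val _ (mem C)) (@enum_val _ (mem C)) M)
           (mxsub (@enum_val _ (mem C)) (@enum_val _ (mem D)) M)
           (mxsub (@enum_val _ (mem D)) (@enum_val _ (mem C)) M)
           (mxsub (@enum_val _ (mem D)) (@enum_val _ (mem D)) M)).
Proof.
move=> dCD; rewrite -mxsub_enum_cat; symmetry; apply: det_mxsub_same_image.
- by apply/esym/eqP; rewrite (leq_card_setU C D).2.
- exact: enum_cat_inj.
move=> i; have iCD : enum_cat i \in C :|: D.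
  rewrite -(fintype.splitK i); case: (fintype.split i) => a /=; rewrite ?enum_catl ?enum_catr inE.
    by rewrite (enum_valP a).
  by rewrite (enum_valP a) orbT.
by exists (enum_rank_in iCD (enum_cat i)); rewrite enum_rankK_in.
Qed.

(** Listing C first makes the matrix block upper triangular, with a scalar
    block for the other rows. *)
Lemma det_scalar_rows (S : comPzRingType) n (C : {set 'I_n}) (M : 'M[S]_n) (x : S) :
  (forall i j, i \notin C -> M i j = x *+ (i == j)) ->
  \det M = \det (mxsub (@enum_val _ (mem C)) (@enum_val _ (mem C)) M) *
           x ^+ #|~: C|.
Proof.
move=> Mx.
have dC : [disjoint C & ~: C] by rewrite -finset.setI_eq0 finset.setICr.
have idM : mxsub id id M = M by apply/matrixP => i j; rewrite mxE.
rewrite -{1}idM -(@det_mxsub_same_image _ (#|C| + #|~: C|) _ _ (@enum_cat n C (~: C))).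
- rewrite mxsub_enum_cat.
  have -> : mxsub (@enum_val _ (mem (~: C))) (@enum_val _ (mem C)) M = 0.
    apply/matrixP => i j; rewrite !mxE Mx.
      case: eqP => // ij; have := enum_valP i.
      by rewrite ij inE (enum_valP j).
    by have := enum_valP i; rewrite inE.
  rewrite det_ublock; congr (_ * _).
  have -> : mxsub (@enum_val _ (mem (~: C))) (@enum_val _ (mem (~: C))) M = x%:M.
    apply/matrixP => i j; rewrite !mxE Mx ?(inj_eq enum_val_inj) //.
    by have := enum_valP i; rewrite inE.
  by rewrite det_scalar.
- by rewrite cardsC card_ord.
- exact: enum_cat_inj.
- by move=> i; exists (enum_cat i).
Qed.

(** Stated with a left inverse rather than with an invertible block, so that it
    applies to polynomial matrices whose corner block is a constant invertible
    matrix. *)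
Lemma det_block_schur (S : comPzRingType) p q (A A' : 'M[S]_p) (B : 'M[S]_(p, q))
    (C : 'M[S]_(q, p)) (D : 'M[S]_q) : A' *m A = 1%:M ->
  \det (block_mx A B C D) = \det A * \det (D - C *m A' *m B).
Proof.
move=> A'A.
have -> : block_mx A B C D =
    block_mx 1%:M 0 (C *m A') 1%:M *m block_mx A B 0 (D - C *m A' *m B).
  rewrite mulmx_block !mul1mx !mul0mx !addr0 -[C *m A' *m A]mulmxA A'A mulmx1.
  by rewrite addrC subrK.
by rewrite det_mulmx det_lblock !det1 !mul1r det_ublock.
Qed.

Section Pencil.
Variables (K : fieldType) (n : nat).
Implicit Types (C D : {set 'I_n}) (s a : 'M[K]_n) (G : {set 'I_n * 'I_n}).

Lemma sub_mx_schur C D s : sub_mx D D (schur C s) =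
  sub_mx D D s - sub_mx D C s *m invmx (sub_mx C C s) *m sub_mx C D s.
Proof.
rewrite /sub_mx /schur; apply/matrixP => i j; rewrite !mxE; congr (_ - _).
apply: eq_bigr => k _; rewrite !mxE; congr (_ * _).
by apply: eq_bigr => k' _; rewrite !mxE.
Qed.

Lemma det_sub_union_schur C D s : [disjoint C & D] ->
  sub_mx C C s \in unitmx ->
  \det (sub_mx (C :|: D) (C :|: D) s) =
  \det (sub_mx C C s) * \det (sub_mx D D (schur C s)).
Proof.
move=> dCD rU; rewrite /sub_mx det_sub_union // -!/(sub_mx _ _ _) sub_mx_schur.
exact: det_block_schur (mulVmx rU).
Qed.

(** With C = C^(l-1) and D = C_l this is the limit of the rescaled matrix z -
    A_eps: the rows of the levels below l lose their diagonal z, those of the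
    levels above l lose their entries of s. *)
Definition pencil C D s : 'M[{poly K}]_n :=
  \matrix_(i, j) ((if i \in C then 0 else 'X) *+ (i == j)
                  - (if i \in C :|: D then (s i j)%:P else 0)).

Lemma det_pencil C D s : [disjoint C & D] -> sub_mx C C s \in unitmx ->
  \det (pencil C D s) = (\det (- sub_mx C C s))%:P *
    char_poly (sub_mx D D (schur C s)) * 'X^#|~: (C :|: D)|.
Proof.
move=> dCD rU; rewrite (det_scalar_rows (C := C :|: D) (x := 'X)); last first.
  by move=> i j iCD; rewrite !mxE (negPf iCD) subr0; move: iCD;
    rewrite inE negb_or => /andP[/negPf-> _].
congr (_ * _); rewrite det_sub_union //.
pose r := sub_mx C C s.
have -> : mxsub (@enum_val _ (mem C)) (@enum_val _ (mem C)) (pencil C D s) =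
    map_mx polyC (- r).
  apply/matrixP => i j; rewrite !mxE inE (enum_valP i) /= mul0rn sub0r.
  by rewrite polyCN.
have -> : mxsub (@enum_val _ (mem C)) (@enum_val _ (mem D)) (pencil C D s) =
    map_mx polyC (- sub_mx C D s).
  by apply/matrixP => i j; rewrite !mxE inE (enum_valP i) /= mul0rn sub0r polyCN.
have DC i : i \in D -> i \in C = false by move=> iD; exact: disjointFl dCD iD.
have -> : mxsub (@enum_val _ (mem D)) (@enum_val _ (mem C)) (pencil C D s) =
    map_mx polyC (- sub_mx D C s).
  apply/matrixP => i j; rewrite !mxE inE (enum_valP i) orbT (DC _ (enum_valP i)).
  case: eqP => [ij|_]; last by rewrite mulr0n sub0r polyCN.
  by have := DC _ (enum_valP i); rewrite ij (enum_valP j).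
have -> : mxsub (@enum_val _ (mem D)) (@enum_val _ (mem D)) (pencil C D s) =
    'X%:M - map_mx polyC (sub_mx D D s).
  apply/matrixP => i j; rewrite !mxE inE (enum_valP i) orbT (DC _ (enum_valP i)).
  by rewrite (inj_eq enum_val_inj).
rewrite (@det_block_schur _ _ _ _ (map_mx polyC (- invmx r))); last first.
  by rewrite -map_mxM mulNmx mulmxN opprK mulVmx // map_mx1.
rewrite det_map_mx; congr (_ * _); rewrite /char_poly /char_poly_mx; congr (\det _).
rewrite sub_mx_schur -!map_mxM -addrA -opprD -map_mxD; congr (_ - map_mx _ _).
by rewrite !(mulNmx, mulmxN, opprK).
Qed.

Lemma det_pencil0 C s : \det (pencil C finset.set0 s) =
  \det (map_mx polyC (- sub_mx C C s)) * 'X^#|~: C|.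
Proof.
rewrite (det_scalar_rows (C := C) (x := 'X)); last first.
  by move=> i j iC; rewrite !mxE finset.setU0 (negPf iC) subr0.
congr (\det _ * _); apply/matrixP => i j.
by rewrite !mxE finset.setU0 (enum_valP i) mul0rn sub0r polyCN.
Qed.

Definition circ G : {set 'I_n * 'I_n} :=
  [set p in G | connect [rel i j | (i, j) \in G] p.2 p.1].

(** The orbit of i under s leads back from s i to i inside G. *)
Lemma circ_perm G (s : 'S_n) : (forall i, s i != i -> (i, s i) \in G) ->
  forall i, ((i, s i) \in circ G) = ((i, s i) \in G).
Proof.
move=> sG i; rewrite inE /=; case: ((i, s i) \in G) => //=.
have fs := @perm_inj _ s.
have : fconnect s (s i) i by rewrite fconnect_sym // fconnect1.
apply: connect_sub => x y /= /eqP <-.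
have [->|sx] := eqVneq (s x) x; first exact: connect0.
by apply: connect1; exact: sG.
Qed.

(** In the Leibniz expansion a permutation contributes only if all its
    non-trivial arcs are in G, and then they are on circuits of G. *)
Lemma det_pencil_circ C D a G :
  \det (pencil C D (graph_part G a)) = \det (pencil C D (graph_part (circ G) a)).
Proof.
apply: eq_bigr => s _; congr (_ * _).
have [/forallP sG|] := boolP [forall i, (s i != i) ==> ((i, s i) \in G)].
  apply: eq_bigr => i _; rewrite !mxE circ_perm // => j sj.
  exact: implyP (sG j) sj.
move=> /forallPn[k]; rewrite negb_imply => /andP[sk skG].
have zero (H : {set 'I_n * 'I_n}) : (k, s k) \notin H ->
    \prod_i pencil C D (graph_part H a) i (s i) = 0.
  move=> skH; apply/eqP/prodf_eq0; exists k => //.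
  by rewrite !mxE (eq_sym k) (negPf sk) (negPf skH) polyC0 if_same subr0.
by rewrite !zero // inE /= (negPf skG).
Qed.

Lemma det_sub_circ C a G :
  \det (sub_mx C C (graph_part G a)) = \det (sub_mx C C (graph_part (circ G) a)).
Proof.
have := det_pencil_circ C finset.set0 a G; rewrite !det_pencil0.
move=> /(mulIf (monic_neq0 (monicXn _ _))).
rewrite !det_map_mx => /polyC_inj; rewrite -!scaleN1r !detZ => /mulfI; apply.
by rewrite signr_eq0.
Qed.

(** Both characteristic polynomials are factors of the same determinant, and
    the cofactors agree and are non-zero. *)
Lemma char_poly_circ C D a G G' : [disjoint C & D] -> circ G = circ G' ->
  sub_mx C C (graph_part G a) \in unitmx ->
  char_poly (sub_mx D D (schur C (graph_part G a))) =
  char_poly (sub_mx D D (schur C (graph_part G' a))).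
Proof.
move=> dCD GG' rU.
have rU' : sub_mx C C (graph_part G' a) \in unitmx.
  by rewrite unitmxE det_sub_circ -GG' -det_sub_circ -unitmxE.
have := det_pencil_circ C D a G; rewrite GG' -det_pencil_circ (det_pencil dCD rU) (det_pencil dCD rU').
move=> /(mulIf (monic_neq0 (monicXn _ _))).
rewrite -!scaleN1r !detZ det_sub_circ GG' -det_sub_circ => /mulfI; apply.
by rewrite polyC_eq0 mulf_neq0 ?signr_eq0 // -unitfE -unitmxE.
Qed.

End Pencil.
End Determinants.

(** * Circuits and potentials of min-plus matrices *)

Section Circuits.
Variable T : eqType.
Implicit Types (c p : seq T) (x y : T).

Lemma circuit_arcs_cons x p : circuit_arcs (x :: p) = zip (x :: p) (rcons p x).
Proof. by rewrite /circuit_arcs /rot /= drop0 take0 cats1. Qed.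

Lemma path_arcs (e : rel T) x p y :
  path e x (rcons p y) = all (fun a => e a.1 a.2) (zip (x :: p) (rcons p y)).
Proof. by elim: p x => [|z p IH] x //=; rewrite IH. Qed.

Lemma cycle_arcs (e : rel T) c :
  cycle e c = all (fun a => e a.1 a.2) (circuit_arcs c).
Proof. by case: c => [//|x p]; rewrite circuit_arcs_cons -path_arcs. Qed.

Lemma unzip1_circuit_arcs c : unzip1 (circuit_arcs c) = c.
Proof. by rewrite unzip1_zip // size_rot. Qed.

Lemma unzip2_circuit_arcs c : unzip2 (circuit_arcs c) = rot 1 c.
Proof. by rewrite unzip2_zip // size_rot. Qed.

Lemma mem_circuit_arcs c a : a \in circuit_arcs c -> a.1 \in c /\ a.2 \in c.
Proof.
move=> ac; split; first by rewrite -{1}(unzip1_circuit_arcs c) map_f.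
by rewrite -(mem_rot 1) -unzip2_circuit_arcs map_f.
Qed.

(** Every node of a circuit is the source of as many arcs as it is the target
    of. *)
Lemma circuit_tele (V : zmodType) (f g : T -> V) c :
  (\sum_(a <- circuit_arcs c) (f a.1 + g a.1 - g a.2) = \sum_(x <- c) f x)%R.
Proof.
rewrite !big_split /= sumrN.
rewrite -(big_map fst xpredT f) -(big_map fst xpredT g) -(big_map snd xpredT g).
rewrite -!/(unzip1 _) -/(unzip2 _) unzip1_circuit_arcs unzip2_circuit_arcs.
by rewrite [X in (_ - X)%R](perm_big c) ?perm_rot //= addrK.
Qed.

Lemma last_arc x p y : (last x p, y) \in zip (x :: p) (rcons p y).
Proof.
elim: p x => [|z p IH] x /=; first by rewrite inE.
by rewrite inE IH orbT.
Qed.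

End Circuits.

Lemma circuit_through (T : finType) (e : rel T) i j :
  (exists2 c, (c != [::]) && cycle e c & (i, j) \in circuit_arcs c) <->
  e i j && connect e j i.
Proof.
split=> [[c /andP[c0 ec] ijc]|/andP[eij /connectP[p ep ip]]].
  rewrite (connect_cycle ec) ?(mem_circuit_arcs ijc) ?andbT //.
  - by move: ec; rewrite cycle_arcs => /allP /(_ _ ijc).
  - by case: (mem_circuit_arcs ijc).
  - by case: (mem_circuit_arcs ijc).
exists (j :: p); first by rewrite /= rcons_path ep -ip.
by rewrite circuit_arcs_cons ip last_arc.
Qed.

(** Connection by a walk with at least one arc; plus_connect e i i says that i
    lies on a circuit. *)
Definition plus_connect (T : finType) (e : rel T) : rel T :=
  fun i j => [exists k, e i k && connect e k j].

Section MinPlusCircuits.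
Variables (R : realType) (n : nat).
Implicit Types (L C : {set 'I_n}) (B : 'M[\bar R]_n) (u : 'I_n -> R) (lam : R).
Local Open Scope classical_set_scope.
Local Open Scope ring_scope.

(** Finite sub-eigenvectors play the role of eigenvectors: they certify lower
    bounds for circuit means, and their equality arcs carry the critical
    circuits. *)
Definition potential L B lam u := forall i j, i \in L -> j \in L ->
  ((lam + u i - u j)%:E <= B i j)%E.

Definition tight L B lam u : rel 'I_n := fun i j =>
  [&& i \in L, j \in L & B i j == (lam + u i - u j)%:E].

Lemma circuit_sum_real B (f : 'I_n * 'I_n -> R) c :
  (forall a, a \in circuit_arcs c -> B a.1 a.2 = (f a)%:E) ->
  (\sum_(a <- circuit_arcs c) B a.1 a.2)%E = (\sum_(a <- circuit_arcs c) f a)%:E.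
Proof.
move=> H; rewrite -sumEFin big_seq [RHS]big_seq; apply: eq_bigr => a; exact: H.
Qed.

Lemma tight_mean B lam u c : c != [::] ->
  (forall a, a \in circuit_arcs c -> B a.1 a.2 = (lam + u a.1 - u a.2)%:E) ->
  circuit_mean B c = lam%:E.
Proof.
move=> c0 H; rewrite /circuit_mean (circuit_sum_real H).
rewrite (circuit_tele (fun=> lam) u) big_const_seq count_predT iter_addr addr0.
rewrite -EFinM -[lam *+ _]mulr_natr mulfK // pnatr_eq0 size_eq0.
exact: c0.
Qed.

(** Along a circuit the differences of u cancel, so the mean exceeds lam by the
    average of the slacks of its arcs. *)
Lemma potential_mean L B lam u c : potential L B lam u -> is_circuit L B c ->
  (lam%:E <= circuit_mean B c)%E /\
  (circuit_mean B c = lam%:E -> cycle (tight L B lam u) c).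
Proof.
move=> pot /and3P[c0 /allP cL]; rewrite cycle_arcs => /allP arcs.
have s0 : 0 < (size c)%:R :> R by rewrite ltr0n lt0n size_eq0.
pose b a := fine (B a.1 a.2).
have Bb a : a \in circuit_arcs c -> B a.1 a.2 = (b a)%:E.
  move=> ac; have [c1 c2] := mem_circuit_arcs ac.
  have := pot _ _ (cL _ c1) (cL _ c2); have := arcs _ ac; rewrite /mp_arc /= /b.
  by case: (B _ _).
have Sb := circuit_sum_real Bb.
pose f (a : 'I_n * 'I_n) := lam + u a.1 - u a.2.
have fb a : a \in circuit_arcs c -> f a <= b a.
  move=> ac; have [c1 c2] := mem_circuit_arcs ac.
  by have := pot _ _ (cL _ c1) (cL _ c2); rewrite Bb // lee_fin.
have Sf : \sum_(a <- circuit_arcs c) f a = lam * (size c)%:R.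
  rewrite (circuit_tele (fun=> lam) u) big_const_seq count_predT iter_addr addr0.
  by rewrite mulr_natr.
have Sfb : \sum_(a <- circuit_arcs c) f a <= \sum_(a <- circuit_arcs c) b a.
  by rewrite big_seq [leRHS]big_seq; apply: ler_sum.
have mE : circuit_mean B c =
    ((\sum_(a <- circuit_arcs c) b a) / (size c)%:R)%:E.
  by rewrite /circuit_mean Sb -EFinM.
split; first by rewrite mE lee_fin ler_pdivlMr // -Sf.
rewrite mE => -[/(canRL (mulfVK (lt0r_neq0 s0)))]; rewrite -Sf => SE.
have : \sum_(a <- circuit_arcs c | a \in circuit_arcs c) (b a - f a) == 0.
  by rewrite -big_seq sumrB SE subrr.
rewrite psumr_eq0 => [|a ac]; last by rewrite subr_ge0 fb.
move=> /allP H; rewrite cycle_arcs; apply/allP => a ac.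
have [c1 c2] := mem_circuit_arcs ac.
rewrite /tight (cL _ c1 : a.1 \in L) (cL _ c2 : a.2 \in L) /= Bb //; have := H _ ac; rewrite ac /= subr_eq0 => /eqP ->.
by [].
Qed.

Lemma potential_rho L B lam u : potential L B lam u ->
  (lam%:E <= rho_min L B)%E.
Proof.
move=> pot; apply: le_ereal_inf_tmp => _ [c cc <-].
by have [] := potential_mean pot cc.
Qed.

Lemma tight_circuit L B lam u c : c != [::] -> cycle (tight L B lam u) c ->
  is_circuit L B c /\ circuit_mean B c = lam%:E.
Proof.
move=> c0; rewrite cycle_arcs => /allP arcs; split.
  apply/and3P; split=> //.
    apply/allP => i; rewrite -{1}(unzip1_circuit_arcs c) => /mapP[a /arcs].
    by rewrite /tight => /and3P[aL _ _] ->.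
  rewrite cycle_arcs; apply/allP => a /arcs /and3P[_ _ /eqP aE].
  by rewrite /mp_arc /= aE.
by apply: (@tight_mean _ _ u) => // a /arcs /and3P[_ _ /eqP].
Qed.

Lemma is_criticalP L B lam u c : potential L B lam u ->
  rho_min L B = lam%:E ->
  is_critical L B c <-> (c != [::]) && cycle (tight L B lam u) c.
Proof.
move=> pot rho; split=> [[cc mc]|/andP[c0 tc]].
  have [_ H] := potential_mean pot cc.
  by case/and3P: cc => -> _ _; apply: H; rewrite mc.
by have [cc mc] := tight_circuit c0 tc; split; rewrite // mc.
Qed.

(** Given a potential for the value rho_min, the critical circuits are the
    circuits of the tight graph. *)
Lemma critical_graphP L B lam u i j : potential L B lam u ->
  rho_min L B = lam%:E ->
  ((i, j) \in critical_graph L B) =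
  tight L B lam u i j && connect (tight L B lam u) j i.
Proof.
move=> pot rho; rewrite inE; apply/asboolP/idP.
  move=> [c /(is_criticalP _ pot rho) cc ijc]; apply/circuit_through.
  by exists c.
move=> /circuit_through [c cc ijc]; exists c => //.
exact/(is_criticalP _ pot rho).
Qed.

Lemma critical_nodesP L B lam u i : potential L B lam u ->
  rho_min L B = lam%:E ->
  (i \in critical_nodes L B) = plus_connect (tight L B lam u) i i.
Proof.
move=> pot rho; rewrite inE; apply/asboolP/fintype.existsP.
  move=> [c /(is_criticalP _ pot rho) cc].
  rewrite -{1}(unzip1_circuit_arcs c) => /mapP[[x j] ac ->].
  by exists j; apply/circuit_through; exists c.
move=> [j /circuit_through[c cc ijc]]; exists c.
  exact/(is_criticalP _ pot rho).
by have [] := mem_circuit_arcs ijc.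
Qed.

End MinPlusCircuits.

Section Potentials.
Variables (R : realType) (n : nat).
Implicit Types (L C : {set 'I_n}) (B : 'M[\bar R]_n) (u : 'I_n -> R) (lam : R).
Local Open Scope classical_set_scope.
Local Open Scope ring_scope.

Definition arc_in L B : rel 'I_n := fun i j => [&& i \in L, j \in L & B i j != +oo%E].

Definition irreducible_on L B := forall i j, i \in L -> j \in L ->
  plus_connect (arc_in L B) i j.

Definition Rmin_on L B := forall i j, i \in L -> j \in L -> B i j != -oo%E.

Lemma finite_gap (I : finType) (g : I -> R) :
  exists2 d, 0 < d & forall i, 0 < g i -> d <= g i.
Proof.
have [d d0 H] : exists2 d, 0 < d & forall i, i \in enum I -> 0 < g i -> d <= g i.
  elim: (enum I) => [|i s [d d0 IH]]; first by exists 1.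
  case: (ltrP 0 (g i)) => gi; last first.
    exists d => // j; rewrite inE => /orP[/eqP-> |/IH//].
    by rewrite ltNge gi.
  exists (Num.min d (g i)); first by rewrite lt_min d0.
  move=> j; rewrite inE ge_min => /orP[/eqP-> _|/IH H /H ->//].
  by rewrite lexx orbT.
by exists d => // i; apply: H; rewrite mem_enum.
Qed.

Lemma finite_lower_bound (I : finType) (g : I -> R) :
  exists m, forall i, m <= g i.
Proof.
have [m H] : exists m, forall i, i \in enum I -> m <= g i.
  elim: (enum I) => [|i s [m IH]]; first by exists 0.
  exists (Num.min m (g i)) => j; rewrite inE ge_min => /orP[/eqP->|/IH ->//].
  by rewrite lexx orbT.
by exists m => i; apply: H; rewrite mem_enum.
Qed.

Lemma plus_connectP (e : rel 'I_n) i j : plus_connect e i j <->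
  exists p, [/\ p != [::], path e i p & last i p = j].
Proof.
split=> [/fintype.existsP[k /andP[eik /connectP[p ep ->]]]|].
  by exists (k :: p); rewrite /= eik.
case=> -[|k p] [] // _ /= /andP[eik ep] <-.
by apply/fintype.existsP; exists k; rewrite eik /=; apply/connectP; exists p.
Qed.

Fixpoint walk_weight (w : 'I_n -> 'I_n -> R) i p : R :=
  if p is j :: p' then w i j + walk_weight w j p' else 0.

Lemma walk_weight_cat w i p q :
  walk_weight w i (p ++ q) = walk_weight w i p + walk_weight w (last i p) q.
Proof. by elim: p i => [|j p IH] i /=; rewrite ?add0r // IH addrA. Qed.

Lemma walk_weight_arcs w i p y : walk_weight w i (rcons p y) =
  \sum_(a <- zip (i :: p) (rcons p y)) w a.1 a.2.
Proof.
elim: p i => [|j p IH] i /=; first by rewrite big_seq1 addr0.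
by rewrite big_cons IH.
Qed.

(** A non-empty closed walk is a circuit, so its weight relative to the minimal
    mean is non-negative. *)
Lemma closed_walk_ge0 L B lam i p : rho_min L B = lam%:E -> Rmin_on L B ->
  path (arc_in L B) i p -> last i p = i ->
  0 <= walk_weight (fun i j => fine (B i j) - lam) i p.
Proof.
move=> rho rmin; case: (lastP p) => [//|q y]; rewrite last_rcons => ep yi.
subst y; rewrite walk_weight_arcs -circuit_arcs_cons.
set c := i :: q.
have arcs : all (fun a => arc_in L B a.1 a.2) (circuit_arcs c).
  by rewrite circuit_arcs_cons -path_arcs.
have Bf a : a \in circuit_arcs c -> B a.1 a.2 = (fine (B a.1 a.2))%:E.
  move=> /(allP arcs) /and3P[a1 a2]; have := rmin _ _ a1 a2.
  by case: (B _ _).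
have cc : is_circuit L B c.
  apply/and3P; split=> //.
    apply/allP => x; rewrite -{1}(unzip1_circuit_arcs c) => /mapP[a /(allP arcs)].
    by move=> /and3P[aL _ _] ->.
  by rewrite cycle_arcs; apply: sub_all arcs => a /and3P[].
have : (rho_min L B <= circuit_mean B c)%E by apply: ereal_inf_lbound; exists c.
have -> : circuit_mean B c =
    ((\sum_(a <- circuit_arcs c) fine (B a.1 a.2)) / (size c)%:R)%:E.
  rewrite /circuit_mean.
  by rewrite (circuit_sum_real (f := fun a => fine (B a.1 a.2)) Bf) -EFinM.
rewrite rho lee_fin ler_pdivlMr ?ltr0n // sumrB subr_ge0.
rewrite [X in _ -> X <= _](_ : _ = lam * (size c)%:R) //.
rewrite big_const_seq count_predT iter_addr addr0 mulr_natr.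
by rewrite size_zip size_rot minnn.
Qed.

Lemma rho_real L B i0 : Rmin_on L B -> irreducible_on L B -> i0 \in L ->
  exists lam, rho_min L B = lam%:E.
Proof.
move=> rmin irr i0L.
have [m mP] := finite_lower_bound (fun p : 'I_n * 'I_n => fine (B p.1 p.2)).
have pot : potential L B m (fun=> 0).
  move=> i j iL jL; rewrite subr0 addr0.
  have := rmin _ _ iL jL; have := mP (i, j) => /=.
  by case: (B i j) => [r| |] //=; rewrite ?leey // lee_fin.
have := potential_rho pot.
have /plus_connectP[p [p0 ep lp]] := irr _ _ i0L i0L.
have arcs : all (fun a => arc_in L B a.1 a.2) (circuit_arcs (belast i0 p)).
  move: p0 lp ep; case: (lastP p) => [//|q y] _; rewrite last_rcons => ->.
  by rewrite belast_rcons circuit_arcs_cons -path_arcs.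
have cc : is_circuit L B (belast i0 p).
  apply/and3P; split.
  - by move: p0; case: (p).
  - apply/allP => x; rewrite -{1}(unzip1_circuit_arcs (belast _ _)).
    by move=> /mapP[a /(allP arcs) /and3P[aL _ _] ->].
  - by rewrite cycle_arcs; apply: sub_all arcs => a /and3P[].
have : (rho_min L B <= circuit_mean B (belast i0 p))%E.
  by apply: ereal_inf_lbound; exists (belast i0 p).
rewrite /circuit_mean.
rewrite (circuit_sum_real (f := fun a => fine (B a.1 a.2))) => [|a].
  rewrite -EFinM; case: (rho_min L B) => [r| |] //.
  by move=> _ _; exists r.
move=> /(allP arcs) /and3P[a1 a2]; have := rmin _ _ a1 a2.
by case: (B _ _).
Qed.

(** The infimum of the weights of the walks to a fixed node r is finite:
    closing a walk with a fixed walk back from r gives a circuit, which bounds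
    it from below. *)
Lemma potential_ex L B lam r : Rmin_on L B -> irreducible_on L B -> r \in L ->
  rho_min L B = lam%:E -> exists u, potential L B lam u.
Proof.
move=> rmin irr rL rho.
pose w i j := fine (B i j) - lam; pose e := arc_in L B.
pose W i : set R := [set walk_weight w i p | p in [set p | path e i p /\ last i p = r]].
have W0 i : i \in L -> W i !=set0.
  move=> iL; have /plus_connectP[p [_ ep lp]] := irr _ _ iL rL.
  by exists (walk_weight w i p); exists p.
have Wlb i : i \in L -> has_lbound (W i).
  move=> iL; have /plus_connectP[q [_ eq lq]] := irr _ _ rL iL.
  exists (- walk_weight w r q) => _ [p [ep lp] <-].
  rewrite lerNl -subr_ge0 opprK addrC -lp -walk_weight_cat.
  apply: (closed_walk_ge0 rho rmin); first by rewrite cat_path ep lp.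
  by rewrite last_cat lp.
exists (fun i => inf (W i)) => i j iL jL.
have := rmin _ _ iL jL; case Bij: (B i j) => [x| |] // _; last by rewrite leey.
rewrite lee_fin.
suff : inf (W i) - (x - lam) <= inf (W j) by lra.
apply: lb_le_inf; first exact: W0.
move=> _ [p [ep lp] <-]; rewrite lerBlDl.
apply: ge_inf; first exact: Wlb.
exists (j :: p); last by rewrite /= /w Bij.
by split=> //=; rewrite /e /arc_in iL jL Bij /=.
Qed.

(** The infimum defining rho_min is attained. Otherwise the tight graph would
    be acyclic, and lowering u i in proportion to the number of nodes that i
    reaches by tight arcs would give a potential for a value larger than
    rho_min. *)
Lemma tight_circuit_ex L B lam u : potential L B lam u ->
  rho_min L B = lam%:E -> exists i, plus_connect (tight L B lam u) i i.
Proof.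
move=> pot rho; apply: contrapT => acyclic.
pose e := tight L B lam u.
pose h i := #|connect e i|.
have hdec i j : e i j -> (h j < h i)%N.
  move=> eij; apply: proper_card; apply/properP; split.
    by apply/fintype.subsetP => k; apply: connect_trans; exact: connect1.
  exists i; first exact: connect0.
  apply/negP => ji; apply: acyclic; exists i; apply/fintype.existsP; exists j.
  by apply/andP; split.
have hn i : (h i <= n)%N by rewrite -[leqRHS]card_ord max_card.
have [d d0 dP] := finite_gap
  (fun p : 'I_n * 'I_n => fine (B p.1 p.2) - (lam + u p.1 - u p.2)).
pose eta := d / n.+1%:R.
have eta0 : 0 < eta by rewrite divr_gt0 ?ltr0n.
have etan : eta * n%:R + eta = d.
  by rewrite -[X in _ + X]mulr1 -mulrDr natr1 divfK // pnatr_eq0.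
(* tight arcs gain eta since h decreases along them; the other ones can afford
   to lose n eta *)
have pot' : potential L B (lam + eta) (fun i => u i - eta * (h i)%:R).
  move=> i j iL jL; have [eij|eij] := boolP (e i j).
    have /and3P[_ _ /eqP->] := eij; rewrite lee_fin.
    have : eta * (h j).+1%:R <= eta * (h i)%:R.
      by rewrite ler_wpM2l ?(ltW eta0) // ler_nat hdec.
    by rewrite -natr1; lra.
  have := pot _ _ iL jL; move: eij (dP (i, j)); rewrite /e /tight iL jL /=.
  case: (B i j) => [x| |]; [|by move=> *; rewrite leey|by []].
  rewrite eqe !lee_fin /= => xN H xge.
  have {H} : d <= x - (lam + u i - u j).
    by apply: H; rewrite subr_gt0 lt_neqAle eq_sym xN.
  have : eta * (h j)%:R <= eta * n%:R by rewrite ler_wpM2l ?(ltW eta0) // ler_nat.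
  have : 0 <= eta * (h i)%:R by rewrite mulr_ge0 ?ler0n ?(ltW eta0).
  by move: etan; lra.
have := potential_rho pot'; rewrite rho lee_fin.
by lra.
Qed.

End Potentials.

(** * The min-plus Schur complement *)

Section SchurStep.
Variables (R : realType) (n : nat) (L : {set 'I_n}) (B : 'M[\bar R]_n).
Variables (lam : R) (u : 'I_n -> R).
Local Open Scope classical_set_scope.
Local Open Scope ring_scope.

Hypothesis rmin : Rmin_on L B.
Hypothesis irr : irreducible_on L B.
Hypothesis pot : potential L B lam u.
Hypothesis rho : rho_min L B = lam%:E.

Let C := critical_nodes L B.
Let N := L :\: C.
Let M := mp_unscale lam B.
Let exit_w := mp_mul C (mp_star C M) M.
Let S := mp_schur C lam B.

Lemma mp_mul_ge m p q (D : {set 'I_p}) (X : 'M[\bar R]_(m, p)) (Y : 'M[\bar R]_(p, q))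
  i j x : (forall k, k \in D -> (x <= X i k + Y k j)%E) -> (x <= mp_mul D X Y i j)%E.
Proof.
move=> H; rewrite mxE; elim/big_ind: _ => [|y z xy xz|k kD].
- by rewrite leey.
- by rewrite le_min xy.
- exact: H.
Qed.

Lemma mp_mul_le m p q (D : {set 'I_p}) (X : 'M[\bar R]_(m, p)) (Y : 'M[\bar R]_(p, q))
  i j k : k \in D -> (mp_mul D X Y i j <= X i k + Y k j)%E.
Proof. by move=> kD; rewrite mxE (bigD1 k) //= ge_min lexx. Qed.

Lemma mp_mul_attained m p q (D : {set 'I_p}) (X : 'M[\bar R]_(m, p))
  (Y : 'M[\bar R]_(p, q)) i j : mp_mul D X Y i j != +oo%E ->
  exists2 k, k \in D & mp_mul D X Y i j = (X i k + Y k j)%E.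
Proof.
rewrite mxE; elim/big_ind: _ => [//|x y IHx IHy|k kD _]; last by exists k.
by rewrite /mine; case: ifP.
Qed.

Lemma critical_sub : C \subset L.
Proof.
apply/fintype.subsetP => i; rewrite (critical_nodesP _ pot rho).
by move=> /fintype.existsP[j /andP[/and3P[]]].
Qed.

Let CL i : i \in C -> i \in L. Proof. exact: (fintype.subsetP critical_sub). Qed.
Let NL i : i \in N -> i \in L. Proof. by rewrite inE => /andP[]. Qed.
Let NC i : i \in N -> i \notin C. Proof. by rewrite inE => /andP[]. Qed.
Let LCN i : i \in L -> i \notin C -> i \in N.
Proof. by rewrite !inE => -> ->. Qed.

Let Mge i j : i \in L -> j \in L -> ((u i - u j)%:E <= M i j)%E.
Proof.
move=> iL jL; have := pot iL jL; rewrite mxE.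
by case: (B i j) => [x| |] //; rewrite ?leey // -EFinB !lee_fin => ?; lra.
Qed.

Let Mneqoo i j : (M i j != +oo%E) = (B i j != +oo%E).
Proof. by rewrite mxE; case: (B i j). Qed.

(** The star is an infimum over infinitely many walks. Slacks take finitely
    many values, so a walk whose slack is smaller than the least positive one
    is made of tight arcs only, and an infimum equal to the bound is reached.
    *)
Lemma walk_gap : exists2 d, 0 < d & forall k i j, i \in C -> j \in L ->
  ((u i - u j)%:E <= mp_pow C M k i j)%E /\
  ((mp_pow C M k i j < (u i - u j + d)%:E)%E -> connect (tight L B lam u) i j).
Proof.
have [d d0 dP] := finite_gap
  (fun p : 'I_n * 'I_n => fine (B p.1 p.2) - (lam + u p.1 - u p.2)).
exists d => // k i j; elim: k i => [|k IH] i iC jL.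
  rewrite /mp_pow /= mxE; case: eqP => [->|_]; last by rewrite leey.
  by rewrite subrr; split=> // _; exact: connect0.
rewrite /mp_pow /= -/(mp_pow C M k); split.
  apply: mp_mul_ge => c cC; have := Mge (CL iC) (CL cC).
  have := (IH _ cC jL).1.
  have -> : u i - u j = (u i - u c) + (u c - u j) by rewrite addrA subrK.
  by move=> H1 H2; rewrite (EFinD (u i - u c)); apply: leeD.
move=> H.
have /mp_mul_attained[c cC E] : mp_mul C M (mp_pow C M k) i j != +oo%E.
  by move: H; apply: contraTneq => ->; rewrite -leNgt leey.
rewrite E in H.
have [H1 H2] := IH _ cC jL.
have H3 := Mge (CL iC) (CL cC).
have := dP (i, c); rewrite /=.
have cL := CL cC; have iL := CL iC.
move: H H1 H2 H3; rewrite mxE.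
case: (mp_pow C M k c j) => [y| |]; [|by case: (B i c)|by case: (B i c)].
case Bic : (B i c) => [x| |] //.
rewrite -!EFinB -EFinD !lee_fin !lte_fin => H H1 H2 H3 H4.
apply: (@connect_trans _ _ c); last by apply: H2; lra.
apply: connect1; rewrite /tight iL cL Bic /= eqe.
have [//|neq] := eqVneq x (lam + u i - u c).
have : d <= x - (lam + u i - u c).
  apply: H4; rewrite subr_gt0 lt_def neq /=.
  by lra.
by lra.
Qed.

Let star_ge i j : i \in C -> j \in L -> ((u i - u j)%:E <= mp_star C M i j)%E.
Proof.
move=> iC jL; have [d d0 H] := walk_gap; rewrite mxE.
by apply: le_ereal_inf_tmp => _ [k _ <-]; exact: (H k i j iC jL).1.
Qed.

Let star_tight i j : i \in C -> j \in L -> mp_star C M i j = (u i - u j)%:E ->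
  connect (tight L B lam u) i j.
Proof.
move=> iC jL; rewrite mxE => E; have [d d0 H] := walk_gap.
have : (ereal_inf (range (fun k => mp_pow C M k i j)) < (u i - u j + d)%:E)%E.
  by rewrite E lte_fin ltrDl.
by move=> /ereal_inf_lt[_ [k _ <-]]; exact: (H k i j iC jL).2.
Qed.

Let star_le k i j : (mp_star C M i j <= mp_pow C M k i j)%E.
Proof. by rewrite mxE; apply: ereal_inf_lbound; exists k. Qed.

Let star_step i k j : i \in C -> k \in C -> j \in C ->
  (mp_star C M i j <= M i k + mp_star C M k j)%E.
Proof.
move=> iC kC jC; have Mik := Mge (CL iC) (CL kC).
case MikE : (M i k) Mik => [x| |] // _; last first.
  have := star_ge kC (CL jC); case: (mp_star C M k j) => [y| |] //= _.
    by rewrite leey.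
  by rewrite leey.
rewrite addeC -leeBlDr //.
rewrite [leRHS]mxE; apply: le_ereal_inf_tmp => _ [l _ <-].
rewrite leeBlDr // addeC -MikE; apply: le_trans (star_le l.+1 i j) _.
exact: mp_mul_le.
Qed.

Lemma exit_weight_ge i j : i \in C -> j \in L -> ((u i - u j)%:E <= exit_w i j)%E.
Proof.
move=> iC jL; apply: mp_mul_ge => k kC.
have := Mge (CL kC) jL; have := star_ge iC (CL kC).
have -> : u i - u j = (u i - u k) + (u k - u j) by rewrite addrA subrK.
by move=> H1 H2; rewrite (EFinD (u i - u k)); apply: leeD.
Qed.

Lemma exit_weight_le i j : i \in C -> (exit_w i j <= M i j)%E.
Proof.
move=> iC; apply: le_trans (mp_mul_le (mp_star C M) M i j iC) _.
rewrite -[leRHS]add0e; apply: leeD => //.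
apply: le_trans (star_le 0 i i) _.
by rewrite /mp_pow /= mxE eqxx.
Qed.

Lemma exit_weight_step i k j : i \in C -> k \in C -> j \in L -> (exit_w i j <= M i k + exit_w k j)%E.
Proof.
move=> iC kC jL.
have [->|] := eqVneq (exit_w k j) +oo%E.
  have := Mge (CL iC) (CL kC).
  by case: (M i k) => [x| |] //= _; rewrite leey.
move=> /mp_mul_attained[l lC]; rewrite -/exit_w => ->.
rewrite addeA; apply: le_trans (mp_mul_le (mp_star C M) M i j lC) _.
by rewrite leeD // star_step.
Qed.

Lemma exit_weight_tight i j : i \in C -> j \in L -> exit_w i j = (u i - u j)%:E ->
  plus_connect (tight L B lam u) i j.
Proof.
move=> iC jL E.
have /mp_mul_attained[k kC] : exit_w i j != +oo%E by rewrite E.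
rewrite -/exit_w E; have := Mge (CL kC) jL; have := star_ge iC (CL kC).
have := star_tight iC (CL kC).
case: (mp_star C M i k) => [y| |]; [|by case: (M k j)|by case: (M k j)].
case MkjE : (M k j) => [x| |] //.
rewrite -EFinD !lee_fin => Ht H1 H2 [] H3.
have /connectP[p ep lp] : connect (tight L B lam u) i k.
  by apply: Ht; congr (_%:E); lra.
have kj : tight L B lam u k j.
  rewrite /tight (CL kC) jL /=; move: MkjE; rewrite mxE.
  by case: (B k j) => [z| |] //; rewrite -EFinB eqe => -[] zE; apply/eqP; lra.
apply/plus_connectP; exists (rcons p j); split.
- by case: (p).
- by rewrite rcons_path ep -lp.
- by rewrite last_rcons.
Qed.

Lemma mp_schurE i j : S i j = mine (B i j) (mp_mul C B exit_w i j).
Proof. by rewrite mxE. Qed.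

Lemma mp_schur_le i j : (S i j <= B i j)%E.
Proof. by rewrite mp_schurE ge_min lexx. Qed.

Lemma mp_schur_le_via i k j : k \in C -> (S i j <= B i k + exit_w k j)%E.
Proof. by move=> kC; rewrite mp_schurE ge_min mp_mul_le ?orbT. Qed.

Lemma mp_schur_potential : potential N S lam u.
Proof.
move=> i j iN jN; rewrite mp_schurE le_min pot ?NL //=.
apply: mp_mul_ge => k kC.
have := pot (NL iN) (CL kC); have := exit_weight_ge kC (NL jN).
have -> : lam + u i - u j = (lam + u i - u k) + (u k - u j).
  by rewrite addrA subrK.
by move=> H1 H2; rewrite (EFinD (lam + u i - u k)); apply: leeD.
Qed.

Lemma mp_schur_Rmin : Rmin_on N S.
Proof.
by move=> i j iN jN; have := mp_schur_potential iN jN; case: (S i j).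
Qed.

(** A tight arc of the Schur complement unfolds into a tight walk of B. *)
Lemma mp_schur_tight i j : tight N S lam u i j -> plus_connect (tight L B lam u) i j.
Proof.
move=> /and3P[iN jN]; rewrite mp_schurE => /eqP SE.
have [BE|BE] := eqVneq (B i j) (lam + u i - u j)%:E.
  apply/fintype.existsP; exists j.
  by rewrite connect0 andbT /tight !NL // BE eqxx.
have E : mp_mul C B exit_w i j = (lam + u i - u j)%:E.
  by move: SE BE; rewrite /mine; case: ifP => // _ ->; rewrite eqxx.
have /mp_mul_attained[k kC] : mp_mul C B exit_w i j != +oo%E by rewrite E.
rewrite E; have := exit_weight_tight kC (NL jN); have := exit_weight_ge kC (NL jN).
have := pot (NL iN) (CL kC).
case: (exit_w k j) => [y| |]; [|by case: (B i k)|by case: (B i k)].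
case BikE : (B i k) => [x| |] //.
rewrite -EFinD !lee_fin => H1 H2 H3 [] H4.
have /plus_connectP[p [_ ep lp]] : plus_connect (tight L B lam u) k j.
  by apply: H3; congr (_%:E); lra.
apply/plus_connectP; exists (k :: p); split=> //=.
rewrite ep andbT /tight (NL iN) (CL kC) BikE /=.
by apply/eqP; congr (_%:E); lra.
Qed.

Let addeNoo (x y : \bar R) : x != +oo%E -> y != +oo%E -> (x + y != +oo)%E.
Proof. by case: x => [x| |]; case: y => [y| |]. Qed.

Let leNoo (x y : \bar R) : (x <= y)%E -> y != +oo%E -> x != +oo%E.
Proof. by move=> xy; apply: contraNneq => xE; rewrite -leye_eq -xE. Qed.

(** Entering C replaces an arc of the Schur complement by the finiteness of the
    weight of an exit from C; both cases are propagated together, backwards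
    along a walk. *)
Lemma mp_schur_irr_step i y j : i \in L -> j \in N -> arc_in L B i y ->
  (y \in N -> connect (arc_in N S) y j) ->
  (y \in C -> exists2 k, k \in N & (exit_w y k != +oo%E) && connect (arc_in N S) k j) ->
  (i \in N -> plus_connect (arc_in N S) i j) /\
  (i \in C -> exists2 k, k \in N & (exit_w i k != +oo%E) && connect (arc_in N S) k j).
Proof.
move=> iL jN /and3P[_ yL Biy] HN HC.
have [yC|yC] := boolP (y \in C).
  have [k kN /andP[SMyk kj]] := HC yC; split=> [iN|iC].
    apply/fintype.existsP; exists k; rewrite kj andbT /arc_in iN kN /=.
    by apply: leNoo (mp_schur_le_via _ _ yC) _; exact: addeNoo.
  exists k => //; rewrite kj andbT; apply: leNoo (exit_weight_step iC yC (NL kN)) _.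
  by apply: addeNoo; rewrite ?Mneqoo.
have yN := LCN yL yC; split=> [iN|iC].
  apply/fintype.existsP; exists y; rewrite HN // andbT /arc_in iN yN /=.
  exact: leNoo (mp_schur_le _ _) Biy.
exists y => //; rewrite HN // andbT; apply: leNoo (exit_weight_le _ iC) _.
by rewrite Mneqoo.
Qed.

Lemma mp_schur_irreducible : irreducible_on N S.
Proof.
move=> i j iN jN.
have conn x : x \in L -> connect (arc_in L B) x j ->
    (x \in N -> connect (arc_in N S) x j) /\
    (x \in C -> exists2 k, k \in N & (exit_w x k != +oo%E) && connect (arc_in N S) k j).
  move=> xL /connectP[p]; elim: p x xL => [|y p IH] x xL /=.
    by move=> _ <-; split=> [_|jC]; [exact: connect0|case/negP: (NC jN)].
  move=> /andP[xy yp jE]; have yL : y \in L by case/and3P: xy.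
  have [HN HC] := IH y yL yp jE.
  have [H1 H2] := mp_schur_irr_step xL jN xy HN HC; split=> // /H1.
  move=> /fintype.existsP[k /andP[xk kj]].
  exact: connect_trans (connect1 xk) kj.
have /fintype.existsP[y /andP[iy yj]] := irr (NL iN) (NL jN).
have yL : y \in L by case/and3P: iy.
have [HN HC] := conn y yL yj.
exact: (mp_schur_irr_step (NL iN) jN iy HN HC).1.
Qed.

(** If the value did not increase, a tight circuit of the Schur complement
    would unfold into a tight circuit of B through a node of N, and that node
    would be critical. *)
Lemma mp_schur_rho i : i \in N -> exists2 lam', rho_min N S = lam'%:E & lam < lam'.
Proof.
move=> iN; have [lam' rho'] := rho_real mp_schur_Rmin mp_schur_irreducible iN.
exists lam' => //.
have := potential_rho mp_schur_potential; rewrite rho' lee_fin le_eqVlt.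
case/orP=> // /eqP lamE; rewrite -lamE in rho'.
have [j /fintype.existsP[k /andP[jk kj]]] := tight_circuit_ex mp_schur_potential rho'.
have jN : j \in N by case/and3P: jk.
case/negP: (NC jN); rewrite (critical_nodesP _ pot rho).
have [x] := fintype.existsP (mp_schur_tight jk) => /andP[jx xk].
apply/fintype.existsP; exists x; rewrite jx /=; apply: connect_trans xk _.
apply: connect_sub kj => a b /mp_schur_tight /fintype.existsP[c /andP[ac cb]].
exact: connect_trans (connect1 ac) cb.
Qed.

(** A node c of C gets the least value of a walk from c that leaves C,
    completed by V at its end. It is finite by irreducibility, and the
    inequalities for the arcs from N to C are those of the Schur complement. *)
Lemma potential_extend (al V : 'I_n -> R) i0 : i0 \in N ->
  (forall i, i \in C -> al i = lam) ->
  (forall i j, i \in N -> j \in N -> ((al i + V i - V j)%:E <= S i j)%E) ->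
  exists V' : 'I_n -> R, forall i j, i \in L -> j \in L ->
    ((al i + V' i - V' j)%:E <= B i j)%E.
Proof.
move=> i0N alC potN.
(* W c is the least value of an exit from c into N *)
pose VN : 'cV[\bar R]_n := \col_i (V i)%:E.
pose W : 'cV[\bar R]_n := mp_mul N exit_w VN.
have VNE j : VN j ord0 = (V j)%:E by rewrite mxE.
have W_le c j : j \in N -> (W c ord0 <= exit_w c j + (V j)%:E)%E.
  by move=> jN; rewrite -VNE; exact: mp_mul_le.
have W_step c d : c \in C -> d \in C -> (W c ord0 <= M c d + W d ord0)%E.
  move=> cC dC; have [->|] := eqVneq (W d ord0) +oo%E.
    have := Mge (CL cC) (CL dC).
    by case: (M c d) => [x| |] //= _; rewrite leey.
  move=> /mp_mul_attained[j jN]; rewrite -/W => ->.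
  rewrite VNE addeA; apply: le_trans (W_le c j jN) _.
  by apply: leeD => //; apply: exit_weight_step => //; exact: NL.
have W_NNy c : c \in C -> W c ord0 != -oo%E.
  move=> cC; have [->//|] := eqVneq (W c ord0) +oo%E.
  move=> /mp_mul_attained[j jN]; rewrite -/W => ->; rewrite VNE.
  by have := exit_weight_ge cC (NL jN); case: (exit_w c j).
have W_Ny c : c \in C -> W c ord0 != +oo%E.
  move=> cC; have /plus_connectP[p [_ ep lp]] := irr (CL cC) (NL i0N).
  elim: p c cC ep lp => [|d p IH] c cC /=.
    by move=> _ ci0; case/negP: (NC i0N); rewrite -ci0.
  move=> /andP[/and3P[cL dL Bcd] dp lp].
  have [dC|dC] := boolP (d \in C).
    apply: leNoo (W_step _ _ cC dC) _; apply: addeNoo; first by rewrite Mneqoo.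
    exact: IH dp lp.
  have dN := LCN dL dC.
  apply: leNoo (W_le c d dN) _; apply: addeNoo => //.
  by apply: leNoo (exit_weight_le _ cC) _; rewrite Mneqoo.
pose V' i := if i \in C then fine (W i ord0) else V i.
have WE c : c \in C -> W c ord0 = (V' c)%:E.
  move=> cC; rewrite /V' cC; have := W_NNy _ cC; have := W_Ny _ cC.
  by case: (W c ord0).
have V'N j : j \in N -> V' j = V j by move=> /NC /negPf; rewrite /V' => ->.
have to_B i x y : ((x - y)%:E <= (B i.1 i.2 - lam%:E))%E ->
    ((lam + x - y)%:E <= B i.1 i.2)%E.
  by case: (B _ _) => [b| |] //; rewrite ?leey // -EFinB !lee_fin => ?; lra.
exists V' => i j iL jL.
have [iC|iC] := boolP (i \in C); have [jC|jC] := boolP (j \in C).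
- rewrite alC //; apply: (to_B (i, j)).
  have := W_step _ _ iC jC; rewrite !WE // [M i j]mxE /=.
  by case: (B i j) => [b| |] //; rewrite ?leey // -EFinB -EFinD !lee_fin => ?; lra.
- have jN := LCN jL jC; rewrite alC // (V'N j jN); apply: (to_B (i, j)).
  have := le_trans (W_le i j jN) (leeD2r _ (exit_weight_le j iC)).
  rewrite WE // mxE /=.
  by case: (B i j) => [b| |] //; rewrite ?leey // -EFinB -EFinD !lee_fin => ?; lra.
- have iN := LCN iL iC; rewrite (V'N i iN).
  have := WE _ jC; have /mp_mul_attained[k kN] := W_Ny _ jC.
  rewrite -/W => -> ; rewrite VNE.
  have := potN _ _ iN kN; have := mp_schur_le_via i k jC.
  move=> H1 H2; have := le_trans H2 H1.
  have := rmin iL jL.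
  case: (B i j) => [b| |] //; last by rewrite leey.
  case: (exit_w j k) => [x| |] //.
  by rewrite -!EFinD !lee_fin => _ H [] <-; lra.
- rewrite !V'N ?LCN //; apply: le_trans (mp_schur_le i j); apply: potN; exact: LCN.
Qed.

End SchurStep.

(** * The levels of an irreducible min-plus matrix *)

Section LevelTheory.
Variables (R : realType) (n : nat) (A : 'M[\bar R]_n).
Hypothesis A_Rmin : is_Rmin A.
Hypothesis A_irr : mp_irreducible A.
Local Open Scope ring_scope.

(** For n = 1 the only node needs a loop, which is what the exclusion of the
    matrix (+oo) provides. *)
Lemma irreducible_onT : irreducible_on [set: 'I_n] A.
Proof.
have [conn ne1] := A_irr.
have sub : subrel (mp_arc A) (arc_in [set: 'I_n] A).
  by move=> x y xy; rewrite /arc_in !inE.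
have first_arc i j : i != j -> plus_connect (arc_in [set: 'I_n] A) i j.
  move=> ij; have /connectP[[|k p] /= ep jE] := conn i j; first by rewrite jE eqxx in ij.
  rewrite {}jE {ij}.
  move: ep => /andP[ik kp]; apply/plus_connectP; exists (k :: p); split=> //=.
  by rewrite sub // (sub_path sub).
move=> i j _ _; have [->|/first_arc//] := eqVneq i j; move: j {i} => i.
have [[k ki]|one] := pselect (exists k, k != i).
  have /fintype.existsP[x /andP[kx xi]] := first_arc _ _ ki.
  rewrite eq_sym in ki.
  have /fintype.existsP[y /andP[iy yk]] := first_arc _ _ ki.
  apply/fintype.existsP; exists y; rewrite iy /=.
  exact: connect_trans yk (connect_trans (connect1 kx) xi).
have alli k : k = i by apply/eqP; apply: contrapT => /negP ki; apply: one; exists k.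
have n1 : n = 1%N.
  rewrite -[LHS]card_ord -(card1 i); apply: eq_card => k.
  by rewrite (alli k) !inE eqxx.
apply/fintype.existsP; exists i; rewrite connect0 andbT /arc_in !inE /=.
apply/negP => /eqP Aii; apply: (ne1 n1); apply/matrixP => x y.
by rewrite mxE (alli x) (alli y).
Qed.

Lemma level_succ l : (0 < l)%N -> level A l.+1 = next_level (level A l).
Proof. by case: l. Qed.

Lemma level_irreducible l : Rmin_on (level A l).1 (level A l).2 /\
  irreducible_on (level A l).1 (level A l).2.
Proof.
elim: l => [|[|l] IH]; try by split; [move=> i j _ _; exact: A_Rmin|exact: irreducible_onT].
rewrite level_succ //; move: (level A l.+1) IH => [L B] /= [rmin irr].
have [i0L|L0] := pselect (exists i, i \in L); last first.
  by split=> i j; rewrite !inE => /andP[_ iL]; exfalso; apply: L0; exists i.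
have [i0 {}i0L] := i0L.
have [lam rho] := rho_real rmin irr i0L.
have [u pot] := potential_ex rmin irr i0L rho.
by rewrite rho; split; [exact: mp_schur_Rmin pot rho|exact: mp_schur_irreducible pot rho].
Qed.

Lemma level_rho_potential l i0 : i0 \in (level A l).1 ->
  rho_min (level A l).1 (level A l).2 = (alpha A l)%:E /\
  exists u, potential (level A l).1 (level A l).2 (alpha A l) u.
Proof.
move=> i0L; have [rmin irr] := level_irreducible l.
have [lam rho] := rho_real rmin irr i0L.
have -> : alpha A l = lam by rewrite /alpha rho.
by split=> //; exact: potential_ex rmin irr i0L rho.
Qed.

Lemma C_lvl_sub l : C_lvl A l \subset (level A l).1.
Proof.
apply/fintype.subsetP => i; rewrite inE => /asboolP[c [/and3P[_ /allP cL _] _] /cL].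
by [].
Qed.

Lemma C_lvl_neq0 l i0 : i0 \in (level A l).1 -> exists i, i \in C_lvl A l.
Proof.
move=> i0L; have [rho [u pot]] := level_rho_potential i0L.
have [i ii] := tight_circuit_ex pot rho.
by exists i; rewrite (critical_nodesP _ pot rho).
Qed.

Lemma C_cumS l : C_cum A l.+1 = C_cum A l :|: C_lvl A l.+1.
Proof. by rewrite /C_cum big_nat_recr. Qed.

Lemma C_cum0 : C_cum A 0 = finset.set0.
Proof. by rewrite /C_cum big_geq. Qed.

Lemma level_set l : (0 < l)%N -> (level A l).1 = N_cum A l.
Proof.
case: l => // l _; rewrite /N_cum /=.
elim: l => [|l IH]; first by rewrite C_cum0 finset.setC0.
rewrite level_succ // /next_level -/(C_lvl A l.+1) /= IH C_cumS.
by apply/setP => i; rewrite !inE negb_or andbC.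
Qed.

Lemma C_cum_sub l m : (l <= m)%N -> C_cum A l \subset C_cum A m.
Proof.
elim: m => [|m IH]; first by rewrite leqn0 => /eqP->.
rewrite leq_eqVlt => /orP[/eqP->//|/IH H].
by apply: fintype.subset_trans H _; rewrite C_cumS finset.subsetUl.
Qed.

Lemma C_lvl_cum l : (0 < l)%N -> C_lvl A l \subset C_cum A l.
Proof. by case: l => // l _; rewrite C_cumS finset.subsetUr. Qed.

Lemma C_lvl_disjoint l : [disjoint C_cum A l.-1 & C_lvl A l].
Proof.
case: l => [|l].
  by rewrite C_cum0 -finset.setI_eq0 finset.set0I.
rewrite disjoint_sym finset.disjoints_subset; apply: fintype.subset_trans (C_lvl_sub _) _.
by rewrite level_set.
Qed.

(** Each level removes at least one node, as long as some remain. *)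
Lemma card_C_cum l : (l <= n)%N -> (l <= #|C_cum A l|)%N.
Proof.
elim: l => [//|l IH] ln.
have [i0 i0L] : exists i, i \in (level A l.+1).1 \/ (l < #|C_cum A l|)%N.
  have [lC|Cl] := ltnP l #|C_cum A l|; first by exists (Ordinal ln); right.
  have /card_gt0P[i iN] : (0 < #|N_cum A l.+1|)%N.
    rewrite /N_cum /= cardsCs finset.setCK card_ord subn_gt0.
    exact: leq_ltn_trans Cl ln.
  by exists i; left; rewrite level_set.
case: i0L => [i0L|lC]; last first.
  by apply: leq_trans lC _; apply: subset_leq_card; exact: C_cum_sub.
have [i iC] := C_lvl_neq0 i0L.
apply: leq_ltn_trans (IH (ltnW ln)) _; apply: proper_card; apply/properP.
split; first exact: C_cum_sub.
exists i; first by rewrite C_cumS inE iC orbT.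
by rewrite (disjointFl (C_lvl_disjoint l.+1) iC).
Qed.

Lemma C_cum_full : C_cum A n = [set: 'I_n].
Proof.
apply/eqP; rewrite eqEcard finset.subsetT cardsT card_ord.
exact: card_C_cum.
Qed.

Lemma nb_levels_le : (nb_levels A <= n)%N.
Proof.
have : has (fun l => C_cum A l == [set: 'I_n]) (iota 0 n.+1).
  by apply/hasP; exists n; rewrite ?mem_iota ?ltnSn // C_cum_full.
by rewrite has_find size_iota.
Qed.

Lemma C_cum_nb : C_cum A (nb_levels A) = [set: 'I_n].
Proof.
have H : has (fun l => C_cum A l == [set: 'I_n]) (iota 0 n.+1).
  by apply/hasP; exists n; rewrite ?mem_iota ?ltnSn // C_cum_full.
have := nth_find 0%N H; rewrite nth_iota ?add0n => [/eqP//|].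
by rewrite -[ltnRHS](size_iota 0) -has_find.
Qed.

Lemma level_nonempty l : (0 < l <= nb_levels A)%N -> exists i, i \in (level A l).1.
Proof.
move=> /andP[l0 ln]; have ln' : (l.-1 < nb_levels A)%N by rewrite prednK.
have := before_find 0%N ln'; rewrite nth_iota ?add0n; last first.
  exact: leq_trans (leq_trans ln' nb_levels_le) (leqnSn _).
move=> /negP H; have [//|none] := pselect (exists i, i \in (level A l).1).
exfalso; apply: H; rewrite -finset.subTset; apply/fintype.subsetP => i _.
apply: contrapT => /negP iC; apply: none; exists i.
by rewrite level_set // /N_cum inE.
Qed.

Lemma level_of_mem i : i \in C_lvl A (level_of A i).
Proof.
have H : has (fun m => i \in C_lvl A m) (iota 1 n).
  have : i \in C_cum A n by rewrite C_cum_full inE.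
  have main m : (m <= n)%N -> i \in C_cum A m ->
      has (fun m => i \in C_lvl A m) (iota 1 n).
    elim: m => [|m IH] mn; first by rewrite C_cum0 inE.
    rewrite C_cumS inE => /orP[/IH H|im]; first by apply: H; exact: ltnW.
    by apply/hasP; exists m.+1 => //; rewrite mem_iota add1n ltnS.
  exact: main.
have := nth_find 0%N H; rewrite nth_iota ?add1n //.
by rewrite -[ltnRHS](size_iota 1) -has_find.
Qed.

Lemma C_cumP i l : (i \in C_cum A l) = (level_of A i <= l)%N.
Proof.
apply/idP/idP => [iC|il]; last first.
  apply: (fintype.subsetP (C_cum_sub il)).
  by apply: (fintype.subsetP (C_lvl_cum _)) (level_of_mem i).
rewrite leqNgt; apply/negP => li.
have := disjointFl (C_lvl_disjoint (level_of A i)) (level_of_mem i).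
by rewrite (fintype.subsetP (C_cum_sub _) _ iC) // -ltnS prednK.
Qed.

Lemma C_lvlP i l : (0 < l)%N -> (i \in C_lvl A l) = (level_of A i == l).
Proof.
move=> l0; apply/idP/eqP => [il|<-]; last exact: level_of_mem.
apply/eqP; rewrite eqn_leq -C_cumP (fintype.subsetP (C_lvl_cum l0) _ il) /=.
rewrite leqNgt; apply/negP => li.
have := disjointFl (C_lvl_disjoint l) il.
by rewrite C_cumP -ltnS prednK // li.
Qed.

Lemma level_ofE i l : (0 < l)%N -> (i \in (level A l).1) = (l <= level_of A i)%N.
Proof. by move=> l0; rewrite level_set // inE C_cumP -ltnNge prednK. Qed.

Lemma level_of_le i : (level_of A i <= nb_levels A)%N.
Proof. by rewrite -C_cumP C_cum_nb inE. Qed.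

Lemma alpha_ltS l : (0 < l < nb_levels A)%N -> alpha A l < alpha A l.+1.
Proof.
move=> /andP[l0 ln].
have [i0 i0L] := @level_nonempty l.+1 ln.
have [i1 i1L] : exists i, i \in (level A l).1.
  by apply: level_nonempty; rewrite l0 ltnW.
have [rmin irr] := level_irreducible l.
have [rho [u pot]] := level_rho_potential i1L.
have [rho' _] := level_rho_potential i0L.
move: rho' i0L; rewrite level_succ // /next_level /= rho /=.
move=> rho' i0N.
by have [lam'] := mp_schur_rho irr pot rho i0N; rewrite rho' => -[<-].
Qed.

Lemma alpha_lt l m : (0 < l)%N -> (l < m <= nb_levels A)%N -> alpha A l < alpha A m.
Proof.
move=> l0; elim: m => [//|m IH] /andP[]; rewrite ltnS leq_eqVlt => /orP[/eqP<-|lm] mn.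
  by apply: alpha_ltS; rewrite l0.
apply: lt_trans (IH _) (alpha_ltS _); first by rewrite lm ltnW.
by rewrite mn (leq_trans l0 (ltnW lm)).
Qed.

(** Downward induction on the level. The last level only uses a potential of
    A_k, and each step back is [potential_extend]. *)
Lemma global_potential : exists V : 'I_n -> R, forall i j,
  ((alpha A (level_of A i) + V i - V j)%:E <= A i j)%E.
Proof.
have [n0|ngt0] := posnP (nb_levels A).
  have noI (i : 'I_n) : False.
    by have := level_of_le i; rewrite n0 leqNgt.
  by exists (fun=> 0) => i; case: (noI i).
(* d counts the levels after the current one *)
have main d : (d < nb_levels A)%N -> exists V : 'I_n -> R, forall i j,
    i \in (level A (nb_levels A - d)).1 -> j \in (level A (nb_levels A - d)).1 ->
    ((alpha A (level_of A i) + V i - V j)%:E <= (level A (nb_levels A - d)).2 i j)%E.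
  elim: d => [_|d IH dn].
    rewrite subn0; have [|i0 i0L] := @level_nonempty (nb_levels A).
      by rewrite ngt0 leqnn.
    have [rho [u pot]] := level_rho_potential i0L.
    exists u => i j iL jL; have -> : level_of A i = nb_levels A.
      by apply/eqP; rewrite eqn_leq level_of_le -level_ofE.
    exact: pot.
  have [V VP] := IH (ltnW dn).
  set l := (nb_levels A - d.+1)%N in VP *.
  have lE : (nb_levels A - d)%N = l.+1 by rewrite /l subnSK // ltnW.
  have l0 : (0 < l)%N by rewrite /l subn_gt0.
  rewrite lE level_succ // in VP.
  have [rmin irr] := level_irreducible l.
  have [i1 i1L] : exists i, i \in (level A l).1.
    by apply: level_nonempty; rewrite l0 leq_subr.
  have [rho [u pot]] := level_rho_potential i1L.
  have [i0 i0L] : exists i, i \in (level A l.+1).1.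
    by apply: level_nonempty; rewrite -lE leq_subr subn_gt0 ltnW.
  rewrite level_succ // /next_level /= in i0L.
  rewrite /next_level /= rho /= in VP.
  apply: (potential_extend rmin irr pot rho i0L _ VP).
  by move=> i; rewrite -/(C_lvl A l) C_lvlP // => /eqP ->.
have [|V VP] := main (nb_levels A).-1; first by rewrite prednK.
exists V => i j; have := VP i j.
have -> : (nb_levels A - (nb_levels A).-1 = 1)%N.
  by rewrite -{1}(prednK ngt0) subSnn.
by rewrite !level_ofE //=; apply.
Qed.

Definition graded_potential (V : 'I_n -> R) := forall i j,
  ((alpha A (level_of A i) + V i - V j)%:E <= A i j)%E.

(** The graph that survives in the limit of the rescaled matrix; it is the
    saturation graph of \hat A at V when V is an eigenvector. *)
Definition tight_graph (V : 'I_n -> R) : {set 'I_n * 'I_n} :=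
  [set p | A p.1 p.2 == (alpha A (level_of A p.1) + V p.1 - V p.2)%:E].

Lemma hatA_tight V i j : tight [set: 'I_n] (hatA A) 0 V i j = ((i, j) \in tight_graph V).
Proof.
rewrite /tight !inE /= !mxE; case: (A i j) => [x| |] //.
by rewrite -EFinB !eqe add0r subr_eq; congr (_ == _); lra.
Qed.

Lemma hatA_potential V : potential [set: 'I_n] (hatA A) 0 V <-> graded_potential V.
Proof.
split=> H i j; last move=> _ _; [have := H i j; rewrite !inE => /(_ isT isT)|have := H i j].
  rewrite mxE; case: (A i j) => [x| |] //; rewrite ?leey // -EFinB !lee_fin => ?; lra.
rewrite mxE; case: (A i j) => [x| |] //; rewrite ?leey // -EFinB !lee_fin => ?; lra.
Qed.

(** The global potential gives rho_min >= 0, and a critical circuit of A, which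
    stays in C_1, has mean 0 for \hat A. *)
Lemma hatA_rho (i0 : 'I_n) : rho_min [set: 'I_n] (hatA A) = 0%:E.
Proof.
have [V VP] := global_potential.
apply/eqP; rewrite eq_le; apply/andP; split; last first.
  by apply: potential_rho; apply/hatA_potential; exact: VP.
have i0L : i0 \in (level A 1).1 by rewrite inE.
have [rho [u pot]] := level_rho_potential i0L.
have [k kC] := C_lvl_neq0 i0L.
move: (kC); rewrite (critical_nodesP _ pot rho) => kk.
have [j /circuit_through[c /andP[c0 cc] _]] := fintype.existsP kk.
have arcs : forall a, a \in circuit_arcs c -> hatA A a.1 a.2 = (0 + u a.1 - u a.2)%:E.
  move: (cc); rewrite cycle_arcs => /allP H a ac.
  have : a.1 \in C_lvl A 1.
    rewrite (critical_nodesP _ pot rho); apply/fintype.existsP; exists a.2.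
    apply/circuit_through; exists c; first by rewrite c0.
    by rewrite -surjective_pairing.
  rewrite C_lvlP // => /eqP l1; have /and3P[_ _ /eqP aE] := H _ ac.
  rewrite mxE l1; move: aE; rewrite /level /= => ->.
  by rewrite -EFinB; congr (_%:E); lra.
have [cc1 _] := tight_circuit c0 cc.
rewrite -(tight_mean c0 arcs); apply: ereal_inf_lbound; exists c => //.
apply/and3P; split=> //; first by apply/allP => x; rewrite !inE.
by rewrite cycle_arcs; apply/allP => a ac; rewrite /mp_arc /= arcs.
Qed.

(** The arcs of a circuit through (i, j) are themselves on a circuit. *)
Lemma circ_idem (G : {set 'I_n * 'I_n}) : circ (circ G) = circ G.
Proof.
pose e : rel 'I_n := [rel i j | (i, j) \in G].
have conn x y : connect e x y -> connect e y x ->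
    connect [rel i j | (i, j) \in circ G] x y.
  move=> /connectP[p ep ->]; elim: p x ep => [|z p IH] x /=; first by rewrite connect0.
  move=> /andP[xz ep] yx; have zp : connect e z (last z p) by apply/connectP; exists p.
  have zx : connect e z x := connect_trans zp yx.
  apply: connect_trans (connect1 _) (IH _ ep _).
    by rewrite /= inE /=; apply/andP; split.
  exact: connect_trans yx (connect1 xz).
apply/setP => -[i j]; rewrite inE /= andb_idr // inE /= => /andP[ij ji].
by apply: conn => //; exact: connect1.
Qed.

Lemma circ_tight_graph V : graded_potential V ->
  circ (tight_graph V) = critical_graph [set: 'I_n] (hatA A).
Proof.
move=> /hatA_potential VP; apply/setP => -[i j].
rewrite (critical_graphP _ _ VP (hatA_rho i)) inE /= hatA_tight.
by congr (_ && _); apply: eq_connect => x y; rewrite hatA_tight.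
Qed.

(** The entries of an eigenvector are finite: an infinite entry would propagate
    along the arcs to all nodes. Being finite, it is a potential, and
    saturation is tightness. *)
Lemma sat_graph_tight W : mp_eigenvector (hatA A) W ->
  exists2 V, graded_potential V & sat_graph (hatA A) W = tight_graph V.
Proof.
move=> [Wmin [i0 Wi0] eigW]; have rho := hatA_rho i0.
have eigE i : mp_mul [set: 'I_n] (hatA A) W i ord0 = W i ord0.
  by rewrite eigW rho add0e.
have le i j : (W i ord0 <= hatA A i j + W j ord0)%E.
  by rewrite -eigE; apply: mp_mul_le; rewrite inE.
have Wy i : W i ord0 != +oo%E.
  have /connectP[p] := A_irr.1 i i0; elim: p i => [|j p IH] i /=; first by move=> _ <-.
  move=> /andP[ij jp] lp; have := IH _ jp lp; have := le i j.
  move: ij; rewrite /mp_arc /= mxE.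
  by case: (A i j) => [x| |] //; case: (W j ord0) => [y| |] //; case: (W i ord0).
have WE i : W i ord0 = (fine (W i ord0))%:E.
  by have := Wmin i ord0; have := Wy i; case: (W i ord0).
pose V i := fine (W i ord0).
have VP : graded_potential V.
  apply/hatA_potential => i j _ _; have := le i j; rewrite (WE i) (WE j).
  rewrite -/(V i) -/(V j); case: (hatA A i j) => [x| |] //; rewrite ?leey //.
  by rewrite -EFinD !lee_fin => ?; lra.
exists V => //; apply/setP => -[i j]; rewrite -hatA_tight inE /= eigE.
rewrite /tight !inE /= (WE i) (WE j) -/(V i) -/(V j).
case: (hatA A i j) => [x| |] //.
by rewrite -EFinD !eqe add0r eq_sym -subr_eq; congr (_ == _); lra.
Qed.

Lemma admissible_circ G : admissible_graph A G ->
  circ G = critical_graph [set: 'I_n] (hatA A).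
Proof.
move=> [->|[W /sat_graph_tight[V VP VG] ->]]; last by rewrite VG circ_tight_graph.
have [V VP] := global_potential.
by rewrite -(circ_tight_graph VP) circ_idem.
Qed.

End LevelTheory.

(** * Eigenvalue germs *)

Section EigenvalueGerms.
Variable R : realType.
Local Open Scope classical_set_scope.
Local Open Scope ring_scope.
Local Notation nc := (@Normc.normc R).
Local Notation C := R[i].

Lemma char_poly_eval (K : fieldType) n (M : 'M[K]_n) (x : K) :
  (char_poly M).[x] = \det (x%:M - M).
Proof.
rewrite /char_poly -horner_evalE -det_map_mx; congr (\det _).
apply/matrixP => i j; rewrite !mxE /= horner_evalE.
by rewrite hornerD hornerN hornerC hornerMn hornerX.
Qed.

Lemma horner_prod_XsubC (K : fieldType) (s : seq K) (x : K) :
  (\prod_(z <- s) ('X - z%:P)).[x] = \prod_(z <- s) (x - z).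
Proof.
elim: s => [|z s IH]; first by rewrite !big_nil hornerC.
by rewrite !big_cons hornerM IH hornerXsubC.
Qed.

Lemma spectrum_ex n (M : 'M[C]_n) : exists s, spectrum M s.
Proof.
have [s sE] := closed_field_poly_normal (char_poly M).
by exists s; rewrite /spectrum sE (monicP (char_poly_monic _)) scale1r.
Qed.

Lemma spectrum_size (K : fieldType) n (M : 'M[K]_n) s : spectrum M s -> size s = n.
Proof.
by move=> Ms; have := size_char_poly M; rewrite Ms size_prod_XsubC => -[].
Qed.

Lemma nc_sum (I : Type) (r : seq I) (F : I -> C) :
  nc (\sum_(i <- r) F i) <= \sum_(i <- r) nc (F i).
Proof.
elim: r => [|i r IH]; first by rewrite !big_nil nc0.
rewrite !big_cons; apply: le_trans (_ : nc (F i) + nc (\sum_(j <- r) F j) <= _).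
  have := nc_triangle (F i + \sum_(j <- r) F j) (\sum_(j <- r) F j) 0.
  by rewrite addrK !subr0.
by rewrite lerD2l.
Qed.

(** Look at a coordinate of largest modulus of an eigenvector. *)
Lemma eigenvalue_bound n (M : 'M[C]_n) s z : spectrum M s -> z \in s ->
  nc z <= \sum_i \sum_j nc (M i j).
Proof.
move=> Ms zs.
have /eigenvalueP[v vM v0] : eigenvalue M z.
  by rewrite eigenvalue_root_char Ms root_prod_XsubC.
have /rV0Pn[j0 _] := v0.
pose j := [arg max_(i > j0) nc (v ord0 i)]%O.
have jmax i : nc (v ord0 i) <= nc (v ord0 j).
  by rewrite /j; case: arg_maxP => // k _; apply.
have vj0 : 0 < nc (v ord0 j).
  rewrite lt_neqAle nc_ge0 andbT eq_sym; apply: contraNneq v0 => vj.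
  apply/eqP/rowP => i; apply/eqP; rewrite mxE -nc_eq0.
  by rewrite eq_le nc_ge0 andbT -vj.
rewrite -(ler_pM2r vj0) -ncM.
have -> : z * v ord0 j = \sum_i v ord0 i * M i j.
  by have := congr1 (fun X : 'rV_n => X ord0 j) vM; rewrite !mxE.
apply: le_trans (nc_sum _ _) _; rewrite mulr_suml; apply: ler_sum => i _.
rewrite ncM mulrC; apply: ler_pM; rewrite ?nc_ge0 //.
by rewrite (bigD1 j) //= lerDl sumr_ge0 // => k _; exact: nc_ge0.
Qed.

Lemma in_C_common n (AA : R -> 'M[C]_n) :
  (forall i j, in_C (fun eps => AA eps i j)) ->
  exists e0 k : R, [/\ 0 < e0, e0 < 1, 0 < k &
   forall t, 0 < t < e0 -> forall i j,
     ccont (fun eps => AA eps i j) t /\ nc (AA t i j) <= t `^ (- k)].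
Proof.
move=> AAC.
suff main (s : seq ('I_n * 'I_n)) :
    exists e0 k : R, [/\ 0 < e0, e0 < 1, 0 < k &
     forall t, 0 < t < e0 -> forall p, p \in s ->
     ccont (fun eps => AA eps p.1 p.2) t /\ nc (AA t p.1 p.2) <= t `^ (- k)].
  have [e0 [k [e00 e01 k0 H]]] := main (enum {: 'I_n * 'I_n}).
  exists e0, k; split=> // t te i j; apply: (H t te (i, j)).
  by rewrite mem_enum.
elim: s => [|[i j] s [e0 [k [e00 e01 k0 H]]]].
  by exists 2^-1, 1; split; rewrite ?invr_gt0 ?ltr0n ?invf_lt1 ?ltr1n.
have [e1 [k1 [e10 k10 Hc Hb]]] := AAC i j.
exists (Num.min e0 e1), (Num.max k k1); split.
- by rewrite lt_min e00.
- by rewrite gt_min e01.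
- by rewrite lt_max k0.
move=> t /andP[t0]; rewrite lt_min => /andP[te0 te1] p.
have t1 : 0 < t <= 1 by rewrite t0 ltW // (lt_trans te0).
have mono x y : x <= y -> t `^ (- x) <= t `^ (- y).
  by move=> xy; apply: ger_powR; rewrite ?lerN2.
rewrite inE => /orP[/eqP->|ps] /=.
  have tin : t \in `]0, e1[ by rewrite in_itv /= t0.
  split; first by apply/ccvgP; exact: Hc tin.
  have := Hb _ tin; rewrite ncE lecR => /le_trans; apply.
  by apply: mono; rewrite le_max lexx orbT.
have [|H1 H2] := H t _ p ps; first by rewrite t0.
by split=> //; apply: le_trans H2 (mono _ _ _); rewrite le_max lexx.
Qed.

(** Polynomial growth of the eigenvalues follows from that of the entries; the
    factor n^2 is absorbed by one more power of eps, for eps < 1 / (n^2 + 1).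
    *)
Lemma eigenvalue_germs_ex n (AA : R -> 'M[C]_n) :
  (forall i j, in_C (fun eps => AA eps i j)) ->
  exists Lam : 'I_n -> R -> C, eigenvalue_germs AA Lam.
Proof.
move=> /in_C_common[e0 [k [e00 e01 k0 H]]].
have /choice[m mP] : forall t, exists s, spectrum (AA t) s.
  by move=> t; exact: spectrum_ex.
have szm t : size (m t) = n by exact: spectrum_size (mP t).
pose J : set R := [set` `]0, e0[].
have JE t : J t = (0 < t < e0) by rewrite /J /= in_itv.
have [|t Jt|l lJ] := @continuous_selection R n J m _ (@interval_is_interval _ _) (fun t _ => szm t).
- exact: interval_open.
- apply: (@roots_cvg _ _ _ _ _ _ [::]); first by apply: filterE => u; rewrite !szm.
  move=> x _; apply: ccvg_near (_ : ccvg _ (fun u => \det (x%:M - AA u)) _).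
    by apply: filterE => u; rewrite -char_poly_eval mP horner_prod_XsubC.
  rewrite -horner_prod_XsubC -mP char_poly_eval.
  apply: ccvg_det => i j.
  have subE u : (x%:M - AA u) i j = x%:M i j - AA u i j by rewrite !mxE.
  rewrite subE; apply: (@ccvg_near _ _ _ _ (fun u => x%:M i j - AA u i j)).
    by apply: filterE => u; rewrite subE.
  apply: ccvgB; first exact: ccvg_cst.
  by rewrite JE in Jt; have [] := H t Jt i j.
have szl t : J t -> size (l t) = n.
  by move=> Jt; rewrite (perm_size (lJ t Jt).1).
exists (fun i t => (l t)`_i); split; last first.
  near=> t; have Jt : J t by rewrite JE; apply/andP; split; near: t;
    [exact: nbhs_right_gt|exact: nbhs_right_lt].
  rewrite mP -(perm_big _ (lJ t Jt).1) /= (big_nth 0) szl // big_mkord.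
  by [].
move=> i.
pose c : R := (n * n).+1%:R^-1.
have c0 : 0 < c by rewrite invr_gt0 ltr0n.
exists (Num.min e0 c), (k + 1); split.
- by rewrite lt_min e00.
- by rewrite addr_gt0.
- move=> t; rewrite in_itv /= lt_min => /andP[t0 /andP[te0 tc]].
  have Jt : J t by rewrite JE t0.
  by have := (lJ t Jt).2 i; rewrite /ccont => /ccvgP.
move=> t; rewrite in_itv /= lt_min => /andP[t0 /andP[te0 tc]].
have Jt : J t by rewrite JE t0.
rewrite ncE lecR.
have li : (l t)`_i \in m t by rewrite -(perm_mem (lJ t Jt).1) mem_nth // szl.
apply: le_trans (eigenvalue_bound (mP t) li) _.
apply: le_trans (_ : \sum_(i < n) \sum_(j < n) t `^ (- k) <= _).
  by apply: ler_sum => a _; apply: ler_sum => b _; have [] := H t _ a b; rewrite ?t0.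
rewrite !sumr_const !card_ord -mulrnA.
rewrite opprD powRD ?(lt0r_neq0 t0) ?implybT // -mulr_natr ler_wpM2l ?powR_ge0 //.
rewrite powRN powRr1 ?(ltW t0) //.
apply: le_trans (_ : (n * n).+1%:R <= _); first by rewrite ler_nat.
by rewrite -[leLHS]invrK lef_pV2 ?posrE ?invr_gt0 ?ltr0n // ltW.
Unshelve. all: by end_near.
Qed.

End EigenvalueGerms.

(** * Roots after scaling *)

Section RootClassification.
Variable R : realType.
Local Open Scope classical_set_scope.
Local Open Scope ring_scope.
Local Notation nc := (@Normc.normc R).
Local Notation C := R[i].

Definition cpow (r t : R) : C := (t `^ r)%:C.

Lemma cpowD r s t : 0 < t -> cpow (r + s) t = cpow r t * cpow s t.
Proof.
by move=> t0; rewrite /cpow powRD ?rmorphM // (lt0r_neq0 t0) implybT.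
Qed.

Lemma cpow0 t : cpow 0 t = 1. Proof. by rewrite /cpow powRr0. Qed.

Lemma cpow_cvg0 r : 0 < r -> ccvg 0^'+ (cpow r) 0.
Proof.
move=> /powR_cvg0 /cvgrPdist_lt H e /H; apply: filterS => t.
by rewrite sub0r normrN subr0 ncC.
Qed.

Lemma cpow_ccont r t : 0 < t -> ccont (cpow r) t.
Proof.
move=> t0; have : {for t, continuous (fun u : R => u `^ r)}.
  apply/differentiable_continuous/derivable1_diffP/derivable_powR.
  by rewrite in_itv /= t0.
move=> /cvgrPdist_lt H e /H; apply: filterS => u.
by rewrite distrC /cpow -rmorphB ncC.
Qed.

Lemma ccvg_nc (T : Type) (F : set_system T) (FF : Filter F) (f : T -> C) y d :
  ccvg F f y -> 0 < d -> \forall t \near F, nc (f t) < nc y + d.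
Proof.
move=> fy d0; apply: filterS (fy _ d0) => t H.
have := nc_triangle (f t) y 0; rewrite !subr0 => /le_lt_trans; apply.
by rewrite addrC ltrD2l.
Qed.

(** The change of variable z = zeta + 1 / x in a product of linear factors. *)
Lemma moebius_prod (K : fieldType) (I : eqType) (r : seq I) (m : I -> K) (zeta x : K) :
  x != 0 -> (forall i, i \in r -> m i != zeta) ->
  \prod_(i <- r) (x - (m i - zeta)^-1) * \prod_(i <- r) (zeta - m i) =
  x ^+ size r * \prod_(i <- r) (zeta + x^-1 - m i).
Proof.
move=> x0; elim: r => [|i r IH] mz; first by rewrite !big_nil expr0.
rewrite !big_cons exprS mulrACA IH => [|j jr]; last by rewrite mz // inE jr orbT.
rewrite [RHS]mulrACA; congr (_ * _).
have mz0 : m i - zeta != 0 by rewrite subr_eq0 mz ?mem_head.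
by field; rewrite x0 mz0.
Qed.

Lemma prod_nseq0 (x : C) k : \prod_(z <- nseq k 0) (x - z) = x ^+ k.
Proof.
elim: k => [|k IH]; first by rewrite big_nil.
by rewrite big_cons IH subr0 exprS.
Qed.

(** Apply w = 1 / (z - zeta) to the roots, for a point zeta where the limit
    does not vanish. The transformed roots are the roots of monic polynomials
    of degree n that converge outside 0, with limit roots 1 / (y - zeta) and, n
    - size ys times, 0. Hence they converge one by one: a root whose transform
    has a non-zero limit converges, and the other ones tend to infinity. *)
Lemma scaled_roots_classify n (mu : 'I_n -> R -> C) (e : R -> C) (c0 : C) (ys : seq C) :
  (exists2 e0 : R, 0 < e0 & forall t, 0 < t < e0 -> forall i, ccont (mu i) t) ->
  c0 != 0 -> (size ys <= n)%N ->
  (forall z, ccvg 0^'+ (fun t => e t * \prod_i (z - mu i t))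
     (c0 * \prod_(y <- ys) (z - y))) ->
  exists sg : 'I_n -> 'I_n, injective sg /\ forall q : 'I_n,
    ((q < size ys)%N -> ccvg 0^'+ (mu (sg q)) ys`_q) /\
    ((size ys <= q)%N -> forall K : R, \forall t \near 0^'+, K < nc (mu (sg q) t)).
Proof.
move=> [e0 e00 mc] c00 dn cvgP.
have F0 : Filter (0 : R)^'+ by exact: at_right_proper_filter.
have natI : injective (fun k : nat => k%:R : C).
  by move=> i j /eqP; rewrite eqr_nat => /eqP.
have [k zys] := inj_avoid ys natI.
set zeta : C := k%:R in zys.
have pz0 : c0 * \prod_(y <- ys) (zeta - y) != 0.
  rewrite mulf_neq0 // prodf_seq_neq0; apply/allP => y yys /=.
  by rewrite subr_eq0; apply: contraNneq zys => ->.
have nz : \forall t \near 0^'+, e t * \prod_i (zeta - mu i t) != 0.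
  exact: ccvg_neq pz0 (cvgP zeta).
have [e1 [e10 e1e0 H1]] : exists e1 : R, [/\ 0 < e1, e1 <= e0 &
    forall t, 0 < t < e1 -> e t * \prod_i (zeta - mu i t) != 0].
  have [d /= d0 dP] := nz.
  exists (Num.min e0 d); split; [by rewrite lt_min e00|by rewrite ge_min lexx|].
  move=> t /andP[t0]; rewrite lt_min => /andP[_ td]; apply: dP => //=.
  by rewrite sub0r normrN gtr0_norm.
pose J : set R := [set` `]0, e1[].
have JE t : J t = (0 < t < e1) by rewrite /J /= in_itv.
have muz t i : J t -> mu i t != zeta.
  rewrite JE => /H1; apply: contraNneq => mi; rewrite mulf_eq0 (bigD1 i) //=.
  by rewrite mi subrr mul0r eqxx orbT.
pose w i t := (mu i t - zeta)^-1.
pose m t := [seq w i t | i <- enum 'I_n].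
have szm t : size (m t) = n by rewrite size_map size_enum_ord.
have mnth t (i : 'I_n) : (m t)`_i = w i t.
  by rewrite (nth_map i) ?size_enum_ord // nth_ord_enum.
(* the limits of the transformed roots, those of the roots that stay bounded
   first *)
pose g (y : C) := (y - zeta)^-1.
pose v := map g ys ++ nseq (n - size ys) 0.
have szv : size v = n by rewrite size_cat size_map size_nseq subnKC.
have nJ : \forall t \near 0^'+, J t.
  near=> t; rewrite JE; apply/andP; split; near: t.
    exact: nbhs_right_gt.
  exact: nbhs_right_lt.
have mv : multi_cvg 0^'+ m v.
  apply: (@roots_cvg _ _ _ _ _ _ [:: 0]).
    by apply: filterE => t; rewrite szm szv.
  move=> x; rewrite inE => x0.
  have yz y : y \in ys -> y != zeta by move=> yys; apply: contraNneq zys => <-.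
  have -> : \prod_(z <- v) (x - z) =
      x ^+ n * (c0 * \prod_(y <- ys) (zeta + x^-1 - y)) /
        (c0 * \prod_(y <- ys) (zeta - y)).
    apply: (mulIf pz0); rewrite divfK //.
    rewrite big_cat /= big_map prod_nseq0 [LHS]mulrCA [RHS]mulrCA [in LHS]mulrAC.
    by rewrite moebius_prod // mulrAC -exprD subnKC.
  have := ccvgM F0 (ccvgM F0 (ccvg_cst F0 (x ^+ n)) (cvgP (zeta + x^-1)))
            (ccvgV F0 pz0 (cvgP zeta)).
  apply: ccvg_near; apply: filterS nJ => t Jt.
  have tn : e t * \prod_i (zeta - mu i t) != 0 by rewrite JE in Jt; exact: H1.
  apply: (mulIf tn); rewrite divfK //.
  have := @moebius_prod C 'I_n (enum 'I_n) (mu^~ t) zeta x x0 (fun i _ => muz t i Jt).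
  have bE (F : 'I_n -> C) : \prod_(i <- enum 'I_n) F i = \prod_i F i.
    by rewrite big_enum; apply: eq_bigl => i.
  rewrite size_enum_ord !bE => mE.
  by rewrite big_map bE [RHS]mulrCA mE mulrCA.
have selm : sel J m m.
  move=> t Jt; split=> // i; have [ltin|nlei] := ltnP i n; last first.
    apply: (@ccont_near _ (fun=> 0)); last exact: ccvg_cst.
    by apply: filterE => u; rewrite nth_default ?szm.
  apply: (@ccont_near _ (w (Ordinal ltin))).
    by apply: filterE => u; rewrite -mnth.
  apply: ccvgV; first by rewrite subr_eq0 muz.
  apply: ccvgB; last exact: ccvg_cst.
  apply: mc; move: Jt; rewrite JE => /andP[-> /lt_le_trans ->//].
have [|s sv slim] := sel_limit (F := (0 : R)^'+) _ _ (fun t _ => szm t) selm szv mv.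
  move=> A [d /= d0 dA]; have m0 : 0 < Num.min d e1 by rewrite lt_min d0.
  exists [set` `]0, Num.min d e1[]; split.
  - near=> t; rewrite /= in_itv /=; apply/andP; split; near: t.
      exact: nbhs_right_gt.
    exact: nbhs_right_lt.
  - move=> t; rewrite /= in_itv /= lt_min => /andP[t0 /andP[td _]].
    by apply: dA => //=; rewrite sub0r normrN gtr0_norm.
  - by move=> t; rewrite /= JE in_itv /= lt_min => /andP[-> /andP[_ ->]].
  - exact: interval_is_interval.
have szs : size s = n by rewrite (perm_size sv).
move: (sv); rewrite perm_sym => /(perm_iotaP 0)[Is pIs vE]; rewrite szs in pIs.
have szI : size Is = n by rewrite (perm_size pIs) size_iota.
have Isn (q : 'I_n) : (nth 0%N Is q < n)%N.
  have : nth 0%N Is q \in iota 0 n by rewrite -(perm_mem pIs) mem_nth ?szI.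
  by rewrite mem_iota add0n.
exists (fun q => Ordinal (Isn q)); split.
  move=> p q [/eqP]; rewrite nth_uniq ?szI // ?(perm_uniq pIs) ?iota_uniq //.
  by move=> /eqP/val_inj.
move=> q; set i := Ordinal _.
have wlim : ccvg 0^'+ (w i) v`_q.
  rewrite vE (nth_map 0%N) ?szI //.
  have -> : w i = (fun t => (m t)`_(nth 0%N Is q)).
    by apply/funext => t; rewrite -mnth.
  exact: slim.
have muE t : J t -> mu i t = zeta + (w i t)^-1.
  by move=> Jt; rewrite /w invrK addrC subrK.
rewrite nth_cat size_map in wlim; split=> qd.
  rewrite qd (nth_map 0) // in wlim.
  have yz : ys`_q - zeta != 0.
    by rewrite subr_eq0; apply: contraNneq zys => <-; exact: mem_nth.
  have yz' : (ys`_q - zeta)^-1 != 0 by rewrite invr_eq0.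
  have := ccvgD F0 (ccvg_cst F0 zeta) (ccvgV F0 yz' wlim).
  rewrite invrK addrC subrK.
  by apply: ccvg_near; apply: filterS nJ => t /muE.
rewrite ltnNge qd /= nth_nseq if_same in wlim.
move=> K; pose r := (`|K| + nc zeta + 1)^-1.
have r0 : 0 < r by rewrite invr_gt0 ltr_wpDl // addr_ge0 ?nc_ge0.
apply: filterS2 nJ (wlim _ r0) => t Jt; rewrite subr0 => wr.
have wt0 : 0 < nc (w i t).
  by rewrite lt_neqAle eq_sym nc_eq0 nc_ge0 invr_eq0 subr_eq0 muz.
have : `|K| + nc zeta + 1 < (nc (w i t))^-1.
  by rewrite -[ltLHS]invrK -/r ltf_pV2 ?posrE.
have <- : nc (mu i t - zeta) = (nc (w i t))^-1.
  apply: (mulIf (lt0r_neq0 wt0)); rewrite mulVf ?lt0r_neq0 // -ncM mulfV ?ncC ?normr1 //.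
  by rewrite subr_eq0 muz.
have := nc_triangle (mu i t) 0 zeta; rewrite subr0 sub0r (_ : nc (- zeta) = nc zeta).
  move=> tri big; have := ler_norm K.
  by move: tri big; move: (nc _) (nc _) (nc _) => *; lra.
by rewrite -sub0r nc_sym subr0.
Unshelve. all: by end_near.
Qed.

End RootClassification.

(** * The eigenvalues at one level *)

Section ScaledLimit.
Variables (R : realType) (n : nat).
Local Open Scope classical_set_scope.
Local Open Scope ring_scope.
Local Notation nc := (@Normc.normc R).
Local Notation C := R[i].
Variables (A : 'M[\bar R]_n) (a : 'M[C]_n) (AA : R -> 'M[C]_n).
Hypothesis A_Rmin : is_Rmin A.
Hypothesis A_irr : mp_irreducible A.
Hypothesis AA_asymp : forall i j,
  asymp_simeq (fun eps => AA eps i j) (a i j) (A i j).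
Variable V : 'I_n -> R.
Hypothesis VP : graded_potential A V.

Lemma horner_det_pencil (K : fieldType) (D E : {set 'I_n}) (s : 'M[K]_n) z :
  (\det (pencil D E s)).[z] = \det (\matrix_(i, j)
    ((if i \in D then 0 else z) *+ (i == j) - (if i \in D :|: E then s i j else 0))).
Proof.
rewrite -horner_evalE -det_map_mx; congr (\det _); apply/matrixP => i j.
rewrite !mxE /= horner_evalE hornerD hornerN hornerMn.
by congr (_ *+ _ - _); case: ifP => _; rewrite ?hornerX ?hornerC // hornerC.
Qed.

(** The normalizing factor e does not depend on z. It is the product of the row
    and column scalings eps^(- mu_i - V_i), eps^V_j with eps^(n alpha_l), where
    mu_i is the minimum of alpha_l and the alpha of the level of i. *)
Lemma scaled_char_poly (Lam : 'I_n -> R -> C) l : (0 < l <= nb_levels A)%N ->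
  (\forall eps \near 0^'+, char_poly (AA eps) = \prod_i ('X - (Lam i eps)%:P)) ->
  exists e : R -> C, forall z, ccvg 0^'+
    (fun t => e t * \prod_i (z - cpow (- alpha A l) t * Lam i t))
    (\det (pencil (C_cum A l.-1) (C_lvl A l) (graph_part (tight_graph A V) a))).[z].
Proof.
move=> /andP[l0 ln] LamP.
have F0 : Filter (0 : R)^'+ by exact: at_right_proper_filter.
pose al := alpha A l; pose be i := alpha A (level_of A i).
pose mu i := Num.min (be i) al.
pose d1 i := cpow (- mu i - V i); pose d2 i := cpow (V i).
have be_lt i : (level_of A i < l)%N -> be i < al.
  by move=> H; apply: (alpha_lt A_Rmin A_irr) => //; rewrite H.
have be_gt i : (l < level_of A i)%N -> al < be i.
  move=> H; apply: (alpha_lt A_Rmin A_irr) => //.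
  by rewrite H (level_of_le A_Rmin A_irr).
have inC i : (i \in C_cum A l.-1) = (level_of A i < l)%N.
  by rewrite (C_cumP A_Rmin A_irr) -ltnS prednK.
have inCD i : (i \in C_cum A l.-1 :|: C_lvl A l) = (level_of A i <= l)%N.
  by rewrite inE inC (C_lvlP A_Rmin A_irr) // orbC -leq_eqVlt.
exists (fun t => (\prod_i d1 i t) * (\prod_i d2 i t) * cpow al t ^+ n) => z.
rewrite horner_det_pencil.
(* the matrix diag(d1) (z t^al - AA t) diag(d2) *)
pose M t : 'M[C]_n := \matrix_(i, j)
  ((d1 i t * d2 j t * (z * cpow al t)) *+ (i == j) - d1 i t * d2 j t * AA t i j).
apply: (@ccvg_near _ _ _ F0 (fun t => \det (M t))).
  near=> t; have t0 : 0 < t by near: t; exact: nbhs_right_gt.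
  have -> : M t = diag_mx (\row_i d1 i t) *m ((z * cpow al t)%:M - AA t)
      *m diag_mx (\row_i d2 i t).
    apply/matrixP => i j; rewrite mul_mx_diag mul_diag_mx !mxE.
    rewrite mulrBr mulrBl mulrAC; congr (_ - _).
      by case: (i == j); rewrite ?mulr1n ?mulr0n ?mulr0 ?mul0r // mulrAC.
    by rewrite mulrAC.
  rewrite !det_mulmx !det_diag -char_poly_eval.
  have -> : char_poly (AA t) = \prod_i ('X - (Lam i t)%:P) by near: t.
  rewrite horner_prod.
  rewrite [X in X * _ * _](eq_bigr (fun i => d1 i t)); last by move=> i _; rewrite mxE.
  rewrite [X in _ * X = _](eq_bigr (fun i => d2 i t)); last by move=> i _; rewrite mxE.
  rewrite mulrAC -[RHS]mulrA; congr (_ * _).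
  have -> : cpow al t ^+ n = \prod_(i < n) cpow al t by rewrite prodr_const card_ord.
  rewrite -big_split /=; apply: eq_bigr => i _; rewrite hornerXsubC mulrBr mulrA.
  by rewrite -cpowD // subrr cpow0 mul1r mulrC.
apply: ccvg_det => i j; rewrite [X in ccvg _ _ X]mxE.
apply: (@ccvg_near _ _ _ F0 (fun t =>
   (d1 i t * d2 j t * (z * cpow al t)) *+ (i == j) - d1 i t * d2 j t * AA t i j)).
  by apply: filterE => t; rewrite mxE.
apply: ccvgB.
  case: eqVneq => [<-|_]; last first.
    rewrite mulr0n; apply: ccvg_near (ccvg_cst _ 0).
    by apply: filterE => t; rewrite mulr0n.
  rewrite mulr1n; apply: (@ccvg_near _ _ _ F0 (fun t => cpow (al - mu i) t * z)).
    near=> t; have t0 : 0 < t by near: t; exact: nbhs_right_gt.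
    rewrite mulr1n [z * _]mulrC mulrA /d1 /d2 -!cpowD //; congr (cpow _ _ * _); lra.
  rewrite inC; case: ltnP => [/be_lt H|H].
    rewrite -[X in ccvg _ _ X](mul0r z); apply: ccvgM; last exact: ccvg_cst.
    by apply: cpow_cvg0; rewrite subr_gt0 /mu gt_min H.
  have -> : al - mu i = 0.
    rewrite /mu; case: (ltnP l (level_of A i)) => [/be_gt H'|H'].
      by rewrite minElt ltNge ltW // subrr.
    have -> : be i = al by rewrite /be /al (eqP (_ : level_of A i == l)) // eqn_leq H' H.
    by rewrite minxx subrr.
  apply: ccvg_near (ccvg_cst _ z); apply: filterE => t.
  by rewrite cpow0 mul1r.
have := AA_asymp i j; have := VP i j; have := @A_Rmin i j.
case AE : (A i j) => [x| |] // _ xV; last first.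
  move=> A0; have -> : (if i \in C_cum A l.-1 :|: C_lvl A l then
     graph_part (tight_graph A V) a i j else 0) = 0.
    have tF : (i, j) \in tight_graph A V = false by rewrite inE /= AE.
    by rewrite mxE tF if_same.
  apply: ccvg_near (ccvg_cst _ 0); apply: filterS A0 => t ->.
  by rewrite mulr0.
rewrite lee_fin in xV => /ccvgP AAlim.
(* the exponent left in the entry (i, j): it vanishes exactly when the arc is
   tight and the level of i is at most l *)
pose r := x - mu i - V i + V j.
apply: (@ccvg_near _ _ _ F0 (fun t => cpow r t * (cpow (- x) t * AA t i j))).
  near=> t; have t0 : 0 < t by near: t; exact: nbhs_right_gt.
  rewrite mulrA /d1 /d2 -!cpowD //; congr (cpow _ _ * _); rewrite /r; lra.
have mu_le : mu i <= be i by rewrite /mu ge_min lexx.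
have [r0|rN0] := eqVneq r 0.
  have tight : (i, j) \in tight_graph A V.
    by rewrite inE /= AE eqe; apply/eqP; move: r0 xV mu_le; rewrite /r -/(be i); lra.
  have -> : i \in C_cum A l.-1 :|: C_lvl A l.
    rewrite inCD leqNgt; apply/negP => /be_gt H.
    move: r0 xV; rewrite /r -/(be i).
    have -> : mu i = al by rewrite /mu minElt ltNge ltW.
    by lra.
  rewrite mxE tight r0; apply: ccvg_near AAlim; apply: filterE => t.
  by rewrite cpow0 mul1r.
have r0 : 0 < r.
  by rewrite lt_neqAle eq_sym rN0 /=; move: xV mu_le; rewrite /r -/(be i); lra.
have -> : (if i \in C_cum A l.-1 :|: C_lvl A l then
     graph_part (tight_graph A V) a i j else 0) = 0.
  rewrite inCD !mxE; case: leqP => // lev; case: ifP => //.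
  rewrite inE /= AE eqe -/(be i) => /eqP xE; exfalso.
  have muE : mu i = be i.
    move: lev; rewrite leq_eqVlt => /orP[/eqP lE|/be_lt H].
      have beE : be i = al by exact: (congr1 (alpha A) lE).
      by rewrite /mu beE minxx.
    by rewrite /mu minElt H.
  by move: r0; rewrite /r xE muE; lra.
rewrite -[X in ccvg _ _ X](mul0r (a i j)); apply: ccvgM => //.
exact: cpow_cvg0.
Unshelve. all: by end_near.
Qed.

End ScaledLimit.

Section LevelEigenvalues.
Variables (R : realType) (n : nat).
Local Open Scope classical_set_scope.
Local Open Scope ring_scope.
Local Notation nc := (@Normc.normc R).
Local Notation C := R[i].

Lemma scaled_limE (f : R -> C) b B :
  scaled_lim f b B <-> ccvg 0^'+ (fun t => cpow (- B) t * f t) b.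
Proof. by split => /ccvgP. Qed.

Lemma nc_cpowM (f : R -> C) B t : nc (cpow (- B) t * f t) = nc (f t) * t `^ (- B).
Proof. by rewrite ncM ncC ger0_norm ?powR_ge0 // mulrC. Qed.

Lemma of_order_oE (f : R -> C) B : scaled_lim f 0 B <-> of_order_o f B.
Proof.
split=> [/scaled_limE H|/cvgrPdist_lt H].
  apply/cvgrPdist_lt => e /H; apply: filterS => t.
  by rewrite subr0 nc_cpowM sub0r normrN ger0_norm // mulr_ge0 ?nc_ge0 ?powR_ge0.
apply/scaled_limE => e /H; apply: filterS => t.
by rewrite subr0 nc_cpowM sub0r normrN ger0_norm // mulr_ge0 ?nc_ge0 ?powR_ge0.
Qed.

Lemma of_order_omegaE (f : R -> C) B :
  (forall K : R, \forall t \near 0^'+, K < nc (cpow (- B) t * f t)) ->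
  of_order_omega f B.
Proof.
move=> H; apply/cvgryPgt => K; apply: filterS (H K) => t.
by rewrite nc_cpowM.
Qed.

Lemma not_of_order_o (f : R -> C) B : of_order_o f B -> ~ of_order f B.
Proof.
move=> /of_order_oE/scaled_limE H [b [b0 /scaled_limE Hb]].
by case/eqP: b0; exact: ccvg_uniq Hb H.
Qed.

Lemma not_of_order_omega (f : R -> C) B : of_order_omega f B -> ~ of_order f B.
Proof.
move=> H [b [b0 /scaled_limE Hb]].
have F0 : ProperFilter (0 : R)^'+ by exact: at_right_proper_filter.
have H1 : \forall t \near 0^'+, nc b + 1 < nc (f t) * t `^ (- B).
  by move/cvgryPgt: H; apply.
have H2 := ccvg_nc F0 Hb ltr01.
have [t [H1t]] := @filter_ex _ _ F0 _ (filterI H1 H2); rewrite nc_cpowM => H2t.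
by have := lt_trans H1t H2t; rewrite ltxx.
Qed.

Lemma nonzeros_perm (K : fieldType) (s : seq K) :
  perm_eq s (nonzeros s ++ nseq (size s - size (nonzeros s)) 0).
Proof.
rewrite perm_sym /nonzeros; set P := fun z : K => z != 0.
have -> : nseq (size s - size [seq z <- s | P z]) 0 = [seq z <- s | predC P z].
  rewrite size_filter -(count_predC P s) addKn -size_filter.
  apply/esym/all_pred1P/allP => z; rewrite mem_filter /= negbK => /andP[/eqP-> _].
  exact: eqxx.
exact: permEl (perm_filterC P s).
Qed.

Variables (A : 'M[\bar R]_n) (a : 'M[C]_n) (AA : R -> 'M[C]_n).
Hypothesis A_Rmin : is_Rmin A.
Hypothesis A_irr : mp_irreducible A.
Hypothesis AA_asymp : forall i j,
  asymp_simeq (fun eps => AA eps i j) (a i j) (A i j).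

Lemma card_levels l : (#|~: (C_cum A l.-1 :|: C_lvl A l)| + #|C_lvl A l| = #|N_cum A l|)%N.
Proof.
have disj := C_lvl_disjoint A l.
have cC (X : {set 'I_n}) : #|~: X| = (n - #|X|)%N.
  by rewrite cardsCs finset.setCK card_ord.
rewrite /N_cum !cC.
have := max_card (mem (C_cum A l.-1 :|: C_lvl A l)); rewrite card_ord.
have /eqP -> : #|C_cum A l.-1 :|: C_lvl A l| == (#|C_cum A l.-1| + #|C_lvl A l|)%N.
  by rewrite (leq_card_setU _ _).2.
by move=> H; rewrite subnDA subnK // leq_subRL // (leq_trans (leq_addr _ _) H).
Qed.

(** The limit polynomial is, up to a non-zero constant, the product of the z -
    y where y runs over the non-zero eigenvalues of t^l and over enough zeros
    to make #N^l roots. *)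
Lemma level_eigenvalues G l mu (Lam : 'I_n -> R -> C) :
  admissible_graph A G -> (1 <= l <= nb_levels A)%N ->
  r_mx A a G l \in unitmx -> spectrum (t_mx A a G l) mu ->
  eigenvalue_germs AA Lam ->
  let lam := nonzeros mu in
  (size lam <= #|N_cum A l|)%N /\
  exists sg : 'I_n -> 'I_n, injective sg /\ forall q : 'I_n,
    [/\ (q < size lam)%N -> asymp_sim (Lam (sg q)) lam`_q (alpha A l),
        (size lam <= q < #|N_cum A l|)%N -> of_order_o (Lam (sg q)) (alpha A l) &
        (#|N_cum A l| <= q)%N -> of_order_omega (Lam (sg q)) (alpha A l)].
Proof.
move=> admG lr rU muS [LamC LamP] lam.
have F0 : Filter (0 : R)^'+ by exact: at_right_proper_filter.
have szmu : size mu = #|C_lvl A l| by exact: spectrum_size muS.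
have szlam : (size lam <= size mu)%N by rewrite size_filter count_size.
have cardN := card_levels l.
have lamN : (size lam <= #|N_cum A l|)%N.
  by rewrite -cardN -szmu (leq_trans szlam) // leq_addl.
split=> //.
have [V VP] := global_potential A_Rmin A_irr.
have [e eP] := scaled_char_poly A_Rmin A_irr AA_asymp VP lr LamP.
pose ys := lam ++ nseq (#|N_cum A l| - size lam) 0.
have szys : size ys = #|N_cum A l| by rewrite size_cat size_nseq subnKC.
have disj := C_lvl_disjoint A l.
pose r := sub_mx (C_cum A l.-1) (C_cum A l.-1) (graph_part G a).
have c0 : \det (- r) != 0.
  by rewrite -scaleN1r detZ mulf_neq0 ?signr_eq0 // -unitfE -unitmxE.
have pE z : (\det (pencil (C_cum A l.-1) (C_lvl A l)
      (graph_part (tight_graph A V) a))).[z] = \det (- r) * \prod_(y <- ys) (z - y).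
  rewrite det_pencil_circ (circ_tight_graph A_Rmin A_irr VP).
  rewrite -(admissible_circ A_Rmin A_irr admG) -det_pencil_circ det_pencil //.
  rewrite !hornerM hornerC hornerXn -mulrA; congr (_ * _).
  rewrite muS horner_prod_XsubC (perm_big _ (nonzeros_perm mu)) /= -/lam.
  rewrite !big_cat /= !prod_nseq0 -mulrA -exprD; congr (_ * _ ^+ _).
  by rewrite szmu -cardN addnC -addnBA // -szmu.
have [||||sg [sgi sgP]] := @scaled_roots_classify R n (fun i t => cpow (- alpha A l) t * Lam i t)
  e (\det (- r)) ys.
- have /choice[ee eeP] : forall i, exists e0 : R, 0 < e0 /\
      forall t, 0 < t < e0 -> ccont (Lam i) t.
    move=> i; have [e0 [k [e00 _ Lc _]]] := LamC i; exists e0; split=> // t te.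
    by apply/ccvgP; apply: Lc; rewrite in_itv.
  have [d d0 dP] := finite_gap ee.
  exists d => // t /andP[t0 td] i; apply: ccvgM; first exact: cpow_ccont.
  apply: (eeP i).2; rewrite t0 (lt_le_trans td) // dP //.
  by case: (eeP i).
- exact: c0.
- by rewrite szys (leq_trans (max_card _)) // card_ord.
- by move=> z; rewrite -pE; exact: eP.
exists sg; split=> // q; have [H1 H2] := sgP q; rewrite szys in H1 H2.
split=> [qlam|/andP[lamq qN]|Nq].
- split.
    have : lam`_q \in lam by exact: mem_nth.
    by rewrite mem_filter => /andP[].
  apply/scaled_limE; have := H1 (leq_trans qlam lamN).
  by rewrite nth_cat qlam.
- apply/of_order_oE/scaled_limE; have := H1 qN.
  by rewrite nth_cat ltnNge lamq /= nth_nseq if_same.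
- by apply: of_order_omegaE => K; exact: H2.
Qed.

(** By the Schur complement formula, det r^(l+1) = det r^l det t^l. *)
Lemma r_mx_unit G : (forall l, (1 <= l <= nb_levels A)%N -> t_mx A a G l \in unitmx) ->
  forall l, (1 <= l <= nb_levels A)%N -> r_mx A a G l \in unitmx.
Proof.
move=> tU; elim=> [//|[|l] IH] lr.
  rewrite unitmxE /r_mx /= C_cum0.
  have det0 m (M : 'M[C]_m) : m = 0%N -> \det M = 1.
    by move=> m0; subst m; exact: det_mx00.
  by rewrite det0 ?unitr1 // finset.cards0.
have lr' : (1 <= l.+1 <= nb_levels A)%N by case/andP: lr => _ /ltnW ->.
have rU := IH lr'; have tUl := tU _ lr'.
have disj := C_lvl_disjoint A l.+1.
rewrite unitmxE /r_mx /= C_cumS det_sub_union_schur //.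
by move: tUl rU; rewrite !unitmxE !unitfE => t0 r0; apply: mulf_neq0.
Qed.

End LevelEigenvalues.

(** * Grouping the eigenvalues *)

Section Regroup.
Local Open Scope ring_scope.

Lemma regroup_ex m c N n : (m <= N)%N -> (m + c + (N - m) = n)%N ->
  exists h : 'I_m + 'I_c + 'I_(N - m) -> 'I_n,
  [/\ injective h, forall j, h (inl (inl j)) = j :> nat,
      forall j, (N <= h (inl (inr j)))%N &
      forall j, (m <= h (inr j) < N)%N].
Proof.
move=> mN nE; pose pos (x : 'I_m + 'I_c + 'I_(N - m)) : nat :=
  match x with
  | inl (inl j) => j | inl (inr j) => N + j | inr j => m + j end.
have posn x : (pos x < n)%N.
  by case: x => [[[j jm]|[j jc]]|[j jk]] /=; lia.
exists (fun x => Ordinal (posn x)); split=> /=.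
- move=> x y /(congr1 val) /=.
  by case: x y => [[[i im]|[i ic]]|[i ik]] [[[j jm]|[j jc]]|[j jk]] /= E;
    rewrite ?addnI; try (by exfalso; lia); congr (_ _); try congr (_ _);
    apply: val_inj => /=; lia.
- by [].
- by move=> j; rewrite leq_addr.
- by move=> [j jk] /=; lia.
Qed.

End Regroup.

Theorem theorem5p1 (R : realType) (n : nat)
    (A : 'M[\bar R]_n) (a : 'M[R[i]]_n) (AA : R -> 'M[R[i]]_n)
    (A_Rmin : is_Rmin A) (A_irr : mp_irreducible A)
    (AA_C : forall i j, in_C (fun eps => AA eps i j))
    (AA_asymp : forall i j,
      asymp_simeq (fun eps => AA eps i j) (a i j) (A i j)) :
  (forall G G', admissible_graph A G -> admissible_graph A G' ->
   forall l, (1 <= l <= nb_levels A)%N ->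
     (r_mx A a G l \in unitmx <-> r_mx A a G' l \in unitmx) /\
     (r_mx A a G l \in unitmx ->
      char_poly (t_mx A a G l) = char_poly (t_mx A a G' l))) /\
  (forall G, admissible_graph A G ->
    (forall l, (1 <= l <= nb_levels A)%N -> r_mx A a G l \in unitmx ->
     forall mu, spectrum (t_mx A a G l) mu ->
     let lam := nonzeros mu in
     let m := size lam in
     exists Lam : 'I_m + 'I_#|C_cum A l.-1| + 'I_(#|N_cum A l| - m) ->
                  R -> R[i],
     [/\ eigenvalue_germs AA Lam,
         forall j, asymp_sim (Lam (inl (inl j))) lam`_j (alpha A l),
         forall j, of_order_omega (Lam (inl (inr j))) (alpha A l) &
         forall j, of_order_o (Lam (inr j)) (alpha A l)]) /\
    ((forall l, (1 <= l <= nb_levels A)%N -> t_mx A a G l \in unitmx) ->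
     exists Lam : 'I_n -> R -> R[i],
     eigenvalue_germs AA Lam /\
     forall l, (1 <= l <= nb_levels A)%N ->
     forall mu, spectrum (t_mx A a G l) mu ->
     let lam := nonzeros mu in
     size lam = #|C_lvl A l| /\
     exists sigma : 'I_(size lam) -> 'I_n,
     [/\ injective sigma,
         forall j, asymp_sim (Lam (sigma j)) lam`_j (alpha A l) &
         forall i, of_order (Lam i) (alpha A l) <->
                   exists j, i = sigma j])).
Proof.
split=> [G G' /(admissible_circ A_Rmin A_irr) GE /(admissible_circ A_Rmin A_irr) GE' l lr|].
  have disj := C_lvl_disjoint A l.
  have GG' : circ G = circ G' by rewrite GE GE'.
  split; last exact: char_poly_circ.
  by rewrite !unitmxE /r_mx det_sub_circ GG' -det_sub_circ.
move=> G admG; have [Lam LamP] := eigenvalue_germs_ex AA_C.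
split=> [l lr rU mu muS lam m|tU].
  have [mN [sg [sgi sgP]]] :=
    level_eigenvalues A_Rmin A_irr AA_asymp admG lr rU muS LamP.
  rewrite -/lam -/m in mN sgP.
  have cN : (m + #|C_cum A l.-1| + (#|N_cum A l| - m) = n)%N.
    rewrite addnAC subnKC // addnC /N_cum cardsC card_ord //.
  have [h [hi h1 h2 h3]] := regroup_ex mN cN.
  have bij : bijective (sg \o h).
    apply: inj_card_bij; first exact: inj_comp.
    by rewrite !card_sum !card_ord cN.
  exists (fun x => Lam (sg (h x))); split.
  - split=> [x|]; first exact: LamP.1.
    apply: filterS LamP.2 => t ->.
    by rewrite (reindex (sg \o h)) //; exact: onW_bij.
  - by move=> j; have [H _ _] := sgP (h (inl (inl j))); rewrite h1 in H; exact: H.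
  - by move=> j; have [_ _ H] := sgP (h (inl (inr j))); apply: H; exact: h2.
  - by move=> j; have [_ H _] := sgP (h (inr j)); apply: H; exact: h3.
have rU := r_mx_unit tU.
exists Lam; split=> // l lr mu muS lam.
have [mN [sg [sgi sgP]]] :=
  level_eigenvalues A_Rmin A_irr AA_asymp admG lr (rU l lr) muS LamP.
rewrite -/lam in mN sgP.
have lamE : lam = mu.
  apply/all_filterP/allP => z zmu; apply: contraTneq (tU l lr) => z0.
  have := char_poly_eval (t_mx A a G l) z.
  rewrite muS horner_prod_XsubC (_ : \prod_(y <- mu) (z - y) = 0); last first.
    by apply/eqP; rewrite prodf_seq_eq0; apply/hasP; exists z; rewrite // subrr eqxx.
  rewrite z0 raddf0 sub0r -scaleN1r detZ => /esym/eqP.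
  by rewrite mulf_eq0 signr_eq0 /= unitmxE unitfE negbK.
have szlam : size lam = #|C_lvl A l| by rewrite lamE; exact: spectrum_size muS.
split=> //.
have lamn : (size lam <= n)%N by rewrite szlam -[leqRHS]card_ord max_card.
exists (fun j => sg (widen_ord lamn j)); split.
- by move=> i j /sgi /(congr1 val) /= ij; apply: val_inj.
- by move=> j; have [H _ _] := sgP (widen_ord lamn j); exact: H (ltn_ord j).
move=> i; split=> [Lo|[j ->]]; last first.
  by have [H _ _] := sgP (widen_ord lamn j); exists lam`_j; exact: H (ltn_ord j).
have [q qi] : exists q, i = sg q.
  by have [sg' _ sgK] := injF_bij sgi; exists (sg' i); rewrite sgK.
have [H1 H2 H3] := sgP q; rewrite qi in Lo *.
have [qlam|lamq] := ltnP q (size lam).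
  by exists (Ordinal qlam); congr sg; exact: val_inj.
have [qN|Nq] := ltnP q #|N_cum A l|.
  by exfalso; apply: not_of_order_o Lo; apply: H2; rewrite lamq.
by exfalso; apply: not_of_order_omega Lo; exact: H3.
Qed.
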